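(* Let $Tr_3$ be the dual graph of the $3$-valent tree $T_3$, and let $\mathcal{S}\subset\mathbb{C}^3\times\mathbb{C}^3$, with coordinates $(p,e,f;x,y,z)$, be defined by $$e+f-y+(-y+z)=0,\qquad e^2+f^2+y^2+(-y+z)^2=0,\qquad p-(x+y)=0 .$$ (1) (Correspondence and random dynamics.) $\mathcal{S}$ is a $3$-dimensional complex quadric, and is the graph of a multi-valued transformation $M:(p,e,f)\mapsto(x,y,z)$ which encodes the extension of holomorphic functions on $Tr_3$: a function $\phi$ on the vertices of $Tr_3$ is holomorphic if and only if, for any two adjacent triangles $OAB$ and $OCD$ of $Tr_3$ sharing the vertex $O$, $$\bigl(\phi(O),\,\phi(A)-\phi(O),\,\phi(B)-\phi(O);\ \phi(C),\,\phi(O)-\phi(C),\,\phi(D)-\phi(C)\bigr)\in\mathcal{S}.$$ A holomorphic function is determined, once given on any one triangle of $Tr_3$, up to a discrete indetermination in the extension process: the values on a triangle $OAB$ can be prescribed arbitrarily, and they determine the values at the two other vertices $C,D$ of the triangle adjacent at $O$ up to exchanging them; continuing in this way from triangle to triangle, every choice made at each step gives rise to a holomorphic function on $Tr_3$. (2) (Action of $Aut(Tr_3)$.) Two holomorphic functions $\phi,\phi'$ on $Tr_3$ are equal up to composition by an element of $Aut(Tr_3)$ if and only if they take the same values on the vertices of two triangles of $Tr_3$, i.e. there are triangles $\Delta,\Delta'$ of $Tr_3$ and a bijection $\sigma$ from the vertices of $\Delta$ to those of $\Delta'$ with $\phi=\phi'\circ\sigma$ on the vertices of $\Delta$. (3)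 (Orbital structure.) On the space $\mathcal{T}=\mathbb{C}\times(\mathbb{C}^2\setminus\{0\})$ of marked triangles, define ${\bf\Delta}\sim{\bf\Delta}'$ if and only if there exist a holomorphic function $\phi$ on $Tr_3$ and marked triangles $\Delta,\Delta'$ of $Tr_3$ such that ${\bf\Delta}=\phi(\Delta)$ and ${\bf\Delta}'=\phi(\Delta')$. Then $\sim$ is an equivalence relation. (4) (Projectivization.) By homogeneity, i.e. passing to the quotient $\mathcal{T}\to\mathbb{C}P^1$, $(p,e,f)\mapsto[e:f]$, the set $\mathcal{S}\cap(\mathcal{T}\times\mathcal{T})$ induces (as its image) a correspondence in $\mathbb{C}P^1\times\mathbb{C}P^1$, and $\sim$ induces an equivalence relation on $\mathbb{C}P^1$ (two points of $\mathbb{C}P^1$ being related when they have representatives in $\mathcal{T}$ related by $\sim$).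
   Context: The graph $Tr_3$ has as vertices the edges of the infinite regular tree $T_3$ of valency $3$, two of them being adjacent in $Tr_3$ if they share a vertex in $T_3$. Thus $Tr_3$ is $4$-valent, is a union of triangles (one for each vertex of $T_3$), and every vertex lies in exactly two triangles; two triangles sharing a vertex are called adjacent. $Aut(Tr_3)$ is its automorphism group, acting on functions by composition. Functions on a graph are complex-valued functions on its vertices. The Laplacian is $\Delta f(x)=\frac{1}{\nu(x)}\sum_{y\sim x}(f(y)-f(x))$, where $y\sim x$ means adjacency and $\nu(x)$ is the valency of $x$; $\phi$ is holomorphic if $\Delta\phi=\Delta\phi^2=0$ ($\phi^2$ the pointwise square). A marked triangle of $Tr_3$ is a triangle with a chosen vertex $O$ and an ordering $(A,B)$ of the two others; its image by $\phi$ is $\phi(O,A,B):=(\phi(O),\phi(A)-\phi(O),\phi(B)-\phi(O))\in\mathbb{C}^3$. Elements $(p,e,f)$ of $\mathcal{T}$ are called marked triangles (degenerate ones, with $e=0$ or $f=0$, are allowed). The map $\mathcal{T}\to\mathbb{C}P^1$ is the quotient by the similarity group $\{z\mapsto\theta z+t:\theta\in\mathbb{C}^*,t\in\mathbb{C}\}$, acting by $(p,e,f)\mapsto(\theta p+t,\theta e,\theta f)$. A correspondence in $\mathbb{C}P^1\times\mathbb{C}P^1$ is a closed algebraic curve in it whose two projections to $\mathbb{C}P^1$ are surjective with finite fibres. *)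

(* Defs.v *)
(* The complex numbers are R[i], for R an arbitrary model of the reals. *)
From HB Require Import structures.
From mathcomp Require Import all_boot all_order all_algebra finmap.
From mathcomp Require Import boolp classical_sets functions cardinality fsbigop.
From mathcomp Require Import reals complex mpoly.
From Stdlib Require Import RelationClasses.

Set Implicit Arguments.
Unset Strict Implicit.
Unset Printing Implicit Defensive.

Import GRing.Theory Num.Theory.

Local Open Scope classical_set_scope.
Local Open Scope ring_scope.

(** * Graphs *)

(* Simple undirected graphs; every type is a choiceType and every relation is
   boolean in classical logic, so this is no restriction. *)
Record graph := Graph {
  vertex :> choiceType;
  adj : rel vertex;
  adj_sym : ssrbool.symmetric adj;
  adj_irrefl : irreflexive adj }.

Arguments adj {g}.

Definition nbrs (G : graph) (x : G) : set G := [set y | adj x y].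

Definition regular (k : nat) (G : graph) : Prop :=
  forall x : G, (nbrs x #= `I_k)%card.

Definition connected (G : graph) : Prop :=
  forall x y : G, exists p : seq G, path adj x p /\ last x p = y.

(* The bound on the size discards the back-and-forth walks along an edge. *)
Definition acyclic (G : graph) : Prop :=
  forall c : seq G, ucycle adj c -> (size c <= 2)%N.

Definition tree (G : graph) : Prop :=
  [/\ inhabited G, connected G & acyclic G].

Definition is_T3 (T : graph) : Prop := tree T /\ regular 3 T.

(* Edges as unordered pairs of adjacent vertices. *)
Definition edges (G : graph) : set (set G) :=
  [set E | exists u v : G, adj u v /\ E = [set u; v]].
Arguments edges : clear implicits.

Definition dual_adj (G : graph) : rel (edges G) :=
  fun E F => (E != F) && `[< val E `&` val F !=set0 >].

Lemma dual_adj_sym (G : graph) : ssrbool.symmetric (@dual_adj G).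
Proof. by move=> E F; rewrite /dual_adj eq_sym setIC. Qed.

Lemma dual_adj_irrefl (G : graph) : irreflexive (@dual_adj G).
Proof. by move=> E; rewrite /dual_adj eqxx. Qed.

Definition dual_graph (G : graph) : graph :=
  Graph (@dual_adj_sym G) (@dual_adj_irrefl G).

Definition is_aut (G : graph) (g : G -> G) : Prop :=
  bijective g /\ forall x y, adj (g x) (g y) = adj x y.

(* [triangle O A B]: O, A, B are pairwise adjacent (hence distinct), that is,
   OAB is a triangle marked by the vertex O and the ordering (A, B). *)
Definition triangle (G : graph) (O A B : G) : Prop :=
  [/\ adj O A, adj O B & adj A B].

Definition triangle_set (G : graph) (D : set G) : Prop :=
  exists O A B : G, triangle O A B /\ D = [set O; A; B].

Definition adjacent_triangles (G : graph) (O A B C D : G) : Prop :=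
  [/\ triangle O A B, triangle O C D & [set O; A; B] <> [set O; C; D]].

(** * Holomorphic functions *)

(* For a locally finite graph; [\sum_(y \in _)] is a sum over a finite set. *)
Definition valency (G : graph) (x : G) : nat := #|` fset_set (nbrs x) |.

Definition laplacian (R : realType) (G : graph) (f : G -> R[i]) (x : G) : R[i] :=
  (valency x)%:R^-1 * \sum_(y \in nbrs x) (f y - f x).

Definition holomorphic (R : realType) (G : graph) (phi : G -> R[i]) : Prop :=
  (forall x, laplacian phi x = 0) /\
  (forall x, laplacian (fun y => phi y ^+ 2) x = 0).

(** * The quadric S *)

(* C^2 and C^3; the regular modules R[i]^o give them their structure of
   vector space over R[i]. *)
Notation C2 R := (R[i]^o * R[i]^o)%type.
Notation C3 R := (R[i]^o * R[i]^o * R[i]^o)%type.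

Definition S_eqs (R : realType) (p e f x y z : R[i]) : Prop :=
  [/\ e + f - y + (- y + z) = 0,
      e ^+ 2 + f ^+ 2 + y ^+ 2 + (- y + z) ^+ 2 = 0
    & p - (x + y) = 0].

Definition calS (R : realType) : set (C3 R * C3 R) :=
  [set w | let: ((p, e, f), (x, y, z)) := w in S_eqs p e f x y z].
Arguments calS : clear implicits.

Definition irreducible_mpoly (F : fieldType) (n : nat) (q : {mpoly F[n]}) : Prop :=
  [/\ q != 0, q \isn't a GRing.unit
    & forall a b : {mpoly F[n]},
        q = a * b -> a \is a GRing.unit \/ b \is a GRing.unit].

(* A d-dimensional quadric of E: a hypersurface of an affine subspace of
   dimension d + 1 (parametrized by u |-> t + L u), defined in it by an
   irreducible polynomial of degree 2; msize is the total degree plus one. *)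
Definition is_quadric (F : fieldType) (E : lmodType F) (d : nat) (X : set E) :
    Prop :=
  exists (L : {linear 'rV[F]_d.+1 -> E}) (t : E) (q : {mpoly F[d.+1]}),
    [/\ injective L, msize q = 3, irreducible_mpoly q
      & X = [set t + L u | u in [set u : 'rV[F]_d.+1 | q.@[u 0] = 0]]].

(* A multi-valued transformation has finitely many values, and at least one,
   at each point. *)
Definition multivalued (A B : Type) (M : A -> set B) : Prop :=
  forall a, M a !=set0 /\ finite_set (M a).

(** * The extension process *)

(* Partial functions are functions to [option R[i]]. *)
Definition initial (R : realType) (G : graph) (O A B : G) (o a b : R[i])
    (F : G -> option R[i]) : Prop :=
  forall x, F x = if x == O then Some o else if x == A then Some a
                  else if x == B then Some b else None.

(* F' extends F, already defined on the triangle OAB, by two values c and d at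
   the new vertices C and D of an adjacent triangle OCD, chosen among those
   allowed by S. *)
Definition extension_step (R : realType) (G : graph) (F F' : G -> option R[i]) :
    Prop :=
  exists (O A B C D : G) (o a b c d : R[i]),
    [/\ adjacent_triangles O A B C D,
        [/\ F O = Some o, F A = Some a & F B = Some b],
        F C = None /\ F D = None,
        calS R ((o, a - o, b - o), (c, o - c, d - c))
      & forall x, F' x = if x == C then Some c else if x == D then Some d
                         else F x].

(* The process may stay put, so that finite runs are included. *)
Definition extension_run (R : realType) (G : graph) (O A B : G) (o a b : R[i])
    (F : nat -> G -> option R[i]) : Prop :=
  initial O A B o a b (F 0%N) /\
  forall n, F n.+1 = F n \/ extension_step (F n) (F n.+1).

Definition run_limit (R : realType) (G : graph) (F : nat -> G -> option R[i])
    (phi : G -> R[i]) : Prop :=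
  forall n x v, F n x = Some v -> phi x = v.

Definition exhaustive (R : realType) (G : graph) (F : nat -> G -> option R[i]) :
    Prop :=
  forall x, exists n, F n x <> None.

(** * The space of marked triangles, and its projectivization *)

Definition calT (R : realType) : set (C3 R) :=
  [set t | let: (p, e, f) := t in (e, f) <> (0, 0)].
Arguments calT : clear implicits.

Definition marked_image (R : realType) (G : graph) (phi : G -> R[i])
    (O A B : G) : C3 R :=
  (phi O, phi A - phi O, phi B - phi O).

Definition sim (R : realType) (G : graph) (t t' : calT R) : Prop :=
  exists (phi : G -> R[i]) (O A B O' A' B' : G),
    [/\ holomorphic phi, triangle O A B, triangle O' A' B',
        val t = marked_image phi O A B & val t' = marked_image phi O' A' B'].

(* The projective line, as the set of lines of C^2. *)
Definition CP1 (R : realType) := {L : {vspace C2 R} | \dim L == 1%N}.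

Definition dir (R : realType) (t : C3 R) : C2 R := (t.1.2, t.2).

Lemma dim_dir (R : realType) (t : calT R) : \dim <[dir (val t)]> == 1%N.
Proof.
rewrite dim_vline; case: t => -[[p e] f] /= /set_mem /= H.
by rewrite eqb1; apply/eqP.
Qed.

(* [proj (p, e, f)] is the point [e : f]. *)
Definition proj (R : realType) (t : calT R) : CP1 R :=
  exist _ <[dir (val t)]>%VS (dim_dir t).

(* The fibres of [proj] are the orbits of the similarity group of C. *)
Lemma proj_eqP (R : realType) (t t' : calT R) :
  proj t = proj t' <->
  exists theta tau : R[i], theta != 0 /\
    val t' = (theta * (val t).1.1 + tau, theta * (val t).1.2, theta * (val t).2).
Proof.
have nz (s : calT R) : dir (sval s) != 0.
  by have := dim_dir s; rewrite dim_vline eqb1.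
split=> [/(congr1 sval) /= E|[th [tau [th0 E]]]].
  have : dir (sval t') \in <[dir (sval t)]>%VS by rewrite E memv_line.
  case/vlineP => th Eth; exists th, ((sval t').1.1 - th * (sval t).1.1).
  split; first by apply/eqP => z; move: (nz t'); rewrite Eth z scale0r eqxx.
  rewrite addrC subrK -[th * (sval t).1.2]/(dir (th *: sval t)).1.
  rewrite -[th * (sval t).2]/(dir (th *: sval t)).2.
  rewrite -[dir (th *: sval t)]/(th *: dir (sval t)) -Eth.
  by case: (sval t') => [[]].
apply: eq_exist => /=; apply/eqP; rewrite eqEdim !dim_vline !nz andbT.
rewrite -memvE; apply/vlineP; exists th^-1.
rewrite {2}/dir E /= /dir; congr pair; rewrite /= /GRing.scale /=;
  by rewrite mulrA mulVf ?mul1r.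
Qed.

Definition bihomogeneous (F : fieldType) (a b : nat) (q : {mpoly F[4]}) : Prop :=
  forall m : 'X_{1..4}, m \in msupp q ->
    (m (inord 0) + m (inord 1) = a)%N /\ (m (inord 2) + m (inord 3) = b)%N.

Definition eval4 (F : fieldType) (q : {mpoly F[4]}) (e f y z : F) : F :=
  q.@[fun i => [:: e; f; y; z]`_i].

(* Closed algebraic curves of CP1 x CP1 (all components of dimension 1) are the
   zero loci of the non-constant bihomogeneous polynomials. *)
Definition algebraic_curve (R : realType) (Z : set (CP1 R * CP1 R)) : Prop :=
  exists (a b : nat) (q : {mpoly R[i][4]}),
    [/\ q != 0, (0 < a + b)%N, bihomogeneous a b q
      & forall P Q : CP1 R, Z (P, Q) <->
          forall e f y z : R[i],
            ((e, f) : C2 R) \in val P -> ((y, z) : C2 R) \in val Q ->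
            eval4 q e f y z = 0].

Definition correspondence (R : realType) (Z : set (CP1 R * CP1 R)) : Prop :=
  [/\ algebraic_curve Z,
      forall P, [set Q | Z (P, Q)] !=set0 /\ finite_set [set Q | Z (P, Q)]
    & forall Q, [set P | Z (P, Q)] !=set0 /\ finite_set [set P | Z (P, Q)]].

Definition projS (R : realType) : set (CP1 R * CP1 R) :=
  [set (proj w.1, proj w.2) |
    w in [set w : calT R * calT R | calS R (val w.1, val w.2)]].
Arguments projS : clear implicits.

Definition projsim (R : realType) (G : graph) (P Q : CP1 R) : Prop :=
  exists t t' : calT R, [/\ proj t = P, proj t' = Q & sim G t t'].

(* Main.v *)
(* Around a vertex x = {t, w} of the dual graph, the differences of a
   holomorphic function with its four neighbours, e, f on the t side and c, d
   on the w side, satisfy e + f + c + d = 0 and e^2 + f^2 + c^2 + d^2 = 0. So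
   c and d have a prescribed sum and a prescribed sum of squares, which
   determines {c, d}; this is S in other coordinates. Once the tree is rooted, a
   holomorphic function is the outcome of independent binary choices at the
   vertices, which gives the extension results; and two holomorphic functions
   with the same values on a triangle are exchanged by a tree isomorphism built
   from the root by matching the values on the two new edges at each vertex.
   For the projectivization, eliminating the scales from the equations of S
   leaves the curve
   (2y - z)^2 (e^2 + f^2) + (e + f)^2 (y^2 + (z - y)^2) = 0. *)
Require Import Defs.
From HB Require Import structures.
From mathcomp Require Import all_boot all_order all_algebra finmap ring zify.
From mathcomp Require Import boolp classical_sets functions cardinality fsbigop.
From mathcomp Require Import reals complex mpoly.
From Stdlib Require Import RelationClasses.

Import GRing.Theory Num.Theory.

Set Implicit Arguments.
Unset Strict Implicit.
Unset Printing Implicit Defensive.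

Local Open Scope classical_set_scope.
Local Open Scope ring_scope.

(** * The quadric S *)

(** Three obstacles shape the proof. A run of the extension process adds triangles in any order and
    may stop short of the whole graph; the invariant [coherent] shows that it can only move away
    from the starting triangle, and that what it reaches can be completed by recursion over the
    tree. Matching values star by star only yields a local isomorphism of trees, whose bijectivity
    is then proved by following parents. Irreducibility of S is a rank argument: the Hessian of a
    product of two affine polynomials has rank at most 2, that of the form defining S has rank 3. *)

Section Extension.
Variable K : numClosedFieldType.
Implicit Types o a b c d s q : K.

Lemma sum_sqr_exists s q : exists c d, c + d = s /\ c ^+ 2 + d ^+ 2 = q.
Proof.
(* The root r plays the role of c - d, since (c - d)^2 = 2 q - s^2. *)
pose r := sqrtC (2 * q - s ^+ 2).
have r2 : r ^+ 2 = 2 * q - s ^+ 2 by rewrite sqrtCK.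
have n2 : (2 : K) != 0 by rewrite pnatr_eq0.
exists ((s + r) / 2), ((s - r) / 2); split; first by field.
have -> : ((s + r) / 2) ^+ 2 + ((s - r) / 2) ^+ 2 = (s ^+ 2 + r ^+ 2) / 2 by field.
by rewrite r2; field.
Qed.

(** Once d' is eliminated, the second equation says that c' is a root of (X - c)(X - d). *)
Lemma sum_sqr_inj c d c' d' :
  c + d = c' + d' -> c ^+ 2 + d ^+ 2 = c' ^+ 2 + d' ^+ 2 ->
  (c', d') = (c, d) \/ (c', d') = (d, c).
Proof.
move=> E1 E2; have Ed : d' = c + d - c' by rewrite E1; ring.
have n2 : (2 : K) != 0 by rewrite pnatr_eq0.
have : 2 * ((c' - c) * (c' - d)) = 0.
  have -> : 2 * ((c' - c) * (c' - d)) =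
    c' ^+ 2 + (c + d - c') ^+ 2 - (c ^+ 2 + d ^+ 2) by ring.
  by rewrite -Ed E2 subrr.
move/eqP; rewrite !mulf_eq0 (negbTE n2) /= !subr_eq0 => /orP[]/eqP Ec; subst.
  by left; congr pair; ring.
by right; congr pair; ring.
Qed.

Definition compatible o a b c d :=
  (a - o) + (b - o) + ((c - o) + (d - o)) = 0 /\
  (a - o) ^+ 2 + (b - o) ^+ 2 + ((c - o) ^+ 2 + (d - o) ^+ 2) = 0.

Lemma compatible_exists o a b : exists c d, compatible o a b c d.
Proof.
have [c [d [E1 E2]]] := sum_sqr_exists (- (a - o + (b - o)))
  (- ((a - o) ^+ 2 + (b - o) ^+ 2)).
by exists (c + o), (d + o); rewrite /compatible !addrK E1 E2 !subrr.
Qed.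

Lemma compatible_uniq o a b c d c' d' :
  compatible o a b c d -> compatible o a b c' d' ->
  (c', d') = (c, d) \/ (c', d') = (d, c).
Proof.
move=> [E1 E2] [E1' E2'].
have [] := @sum_sqr_inj (c - o) (d - o) (c' - o) (d' - o).
- by apply: (addrI (a - o + (b - o))); rewrite E1 E1'.
- by apply: (addrI ((a - o) ^+ 2 + (b - o) ^+ 2)); rewrite E2 E2'.
- by case=> /addIr-> /addIr->; left.
- by case=> /addIr-> /addIr->; right.
Qed.

Lemma compatible_swapl o a b c d :
  compatible o a b c d -> compatible o b a c d.
Proof. by rewrite /compatible (addrC (b - o)) (addrC ((b - o) ^+ 2)). Qed.

Lemma compatible_swapr o a b c d :
  compatible o a b c d -> compatible o a b d c.
Proof. by rewrite /compatible (addrC (d - o)) (addrC ((d - o) ^+ 2)). Qed.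

Lemma compatible_flip o a b c d :
  compatible o a b c d -> compatible o c d a b.
Proof. by move=> [E1 E2]; split; rewrite addrC. Qed.

Lemma compatible_affine (th ta : K) o a b c d : compatible o a b c d ->
  compatible (th * o + ta) (th * a + ta) (th * b + ta) (th * c + ta) (th * d + ta).
Proof.
move=> [E1 E2]; split.
  by rewrite -[RHS](mulr0 th) -E1; ring.
by rewrite -[RHS](mulr0 (th ^+ 2)) -E2; ring.
Qed.

(** As a^2 - o^2 = (a - o)^2 + 2 o (a - o), the two second equations differ by 2 o times the
    first. *)
Lemma compatible_laplace o a b c d :
  compatible o a b c d <->
  (a - o) + (b - o) + ((c - o) + (d - o)) = 0 /\
  (a ^+ 2 - o ^+ 2) + (b ^+ 2 - o ^+ 2) + ((c ^+ 2 - o ^+ 2) + (d ^+ 2 - o ^+ 2)) = 0.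
Proof.
suff E : (a ^+ 2 - o ^+ 2) + (b ^+ 2 - o ^+ 2) +
    ((c ^+ 2 - o ^+ 2) + (d ^+ 2 - o ^+ 2)) =
    ((a - o) ^+ 2 + (b - o) ^+ 2 + ((c - o) ^+ 2 + (d - o) ^+ 2)) +
    2 * o * ((a - o) + (b - o) + ((c - o) + (d - o))).
  by rewrite /compatible E; split=> -[E1 E2]; split=> //;
     move: E2; rewrite E1 mulr0 addr0.
by ring.
Qed.

End Extension.

Lemma S_eqs_compatible (R : realType) (o a b c d : R[i]) :
  S_eqs o (a - o) (b - o) c (o - c) (d - c) <-> compatible o a b c d.
Proof.
rewrite /S_eqs /compatible.
have e1 : a - o + (b - o) - (o - c) + (- (o - c) + (d - c)) =
  a - o + (b - o) + (c - o + (d - o)) by ring.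
have e2 : (a - o) ^+ 2 + (b - o) ^+ 2 + (o - c) ^+ 2 + (- (o - c) + (d - c)) ^+ 2 =
  (a - o) ^+ 2 + (b - o) ^+ 2 + ((c - o) ^+ 2 + (d - o) ^+ 2) by ring.
have e3 : o - (c + (o - c)) = 0 by ring.
by rewrite e1 e2 e3; split=> [[]|[]].
Qed.

(** The increments - y and z - y lead from the shared vertex to the two new ones. In them the
    equations separate the triangles, so [sum_sqr_exists] and [sum_sqr_inj] apply on either side. *)
Lemma S_eqs_split (R : realType) (p e f x y z : R[i]) :
  S_eqs p e f x y z <->
  [/\ e + f = - ((- y) + (z - y)), e ^+ 2 + f ^+ 2 = - ((- y) ^+ 2 + (z - y) ^+ 2)
    & p = x + y].
Proof.
split=> -[E1 E2 E3]; split.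
- by apply/eqP; rewrite -subr_eq0 -E1; apply/eqP; ring.
- by apply/eqP; rewrite -subr_eq0 -E2; apply/eqP; ring.
- by apply/eqP; rewrite -subr_eq0 E3.
- by rewrite E1; ring.
- by rewrite E2; ring.
- by rewrite E3 subrr.
Qed.

Lemma S_eqs_right_total (R : realType) (p e f : R[i]) :
  exists x y z, S_eqs p e f x y z.
Proof.
have [c [d [E1 E2]]] := sum_sqr_exists (- (e + f)) (- (e ^+ 2 + f ^+ 2)).
exists (p + c), (- c), (d - c); apply/S_eqs_split.
have -> : d - c - - c = d by ring.
by rewrite !opprK addrK E1 E2 !opprK.
Qed.

(** The second triple is the same new triangle marked at D instead of C. *)
Lemma S_eqs_right_uniq (R : realType) (p e f x y z x' y' z' : R[i]) :
  S_eqs p e f x y z -> S_eqs p e f x' y' z' ->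
  (x', y', z') = (x, y, z) \/ (x', y', z') = (p - (y - z), y - z, - z).
Proof.
move=> /S_eqs_split[E1 E2 ->] /S_eqs_split[E1' E2' E3].
have Ex : x' = x + y - y' by rewrite E3 addrK.
have [] := @sum_sqr_inj _ (- y) (z - y) (- y') (z' - y').
- by apply: oppr_inj; rewrite -E1 -E1'.
- by apply: oppr_inj; rewrite -E2 -E2'.
- by case=> /oppr_inj Ey; rewrite Ex Ey addrK => /addIr->; left.
- case=> Ey Ez; right.
  have Ey' : y' = y - z by rewrite -[y']opprK Ey opprB.
  by rewrite Ex Ey'; congr (_, _, _); rewrite -[z'](subrK y') Ez Ey'; ring.
Qed.

Lemma S_eqs_left_total (R : realType) (x y z : R[i]) :
  exists e f, S_eqs (x + y) e f x y z.
Proof.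
have [e [f [E1 E2]]] := sum_sqr_exists (- (- y + (z - y))) (- ((- y) ^+ 2 + (z - y) ^+ 2)).
by exists e, f; apply/S_eqs_split.
Qed.

Lemma S_eqs_left_uniq (R : realType) (p e f p' e' f' x y z : R[i]) :
  S_eqs p e f x y z -> S_eqs p' e' f' x y z ->
  (p', e', f') = (p, e, f) \/ (p', e', f') = (p, f, e).
Proof.
move=> /S_eqs_split[E1 E2 ->] /S_eqs_split[E1' E2' ->].
have [] := @sum_sqr_inj _ e f e' f'.
- by rewrite E1.
- by rewrite E2.
- by case=> -> ->; left.
- by case=> -> ->; right.
Qed.

Lemma S_eqs_homothety (R : realType) (th p e f x y z : R[i]) :
  S_eqs p e f x y z ->
  S_eqs (th * p) (th * e) (th * f) (th * x) (th * y) (th * z).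
Proof.
move=> [E1 E2 E3]; split.
- by rewrite -[RHS](mulr0 th) -E1; ring.
- by rewrite -[RHS](mulr0 (th ^+ 2)) -E2; ring.
- by rewrite -[RHS](mulr0 th) -E3; ring.
Qed.

Lemma S_eqs_translate (R : realType) (ta p e f x y z : R[i]) :
  S_eqs p e f x y z -> S_eqs (p + ta) e f (x + ta) y z.
Proof. by move=> [E1 E2 E3]; split=> //; rewrite -E3; ring. Qed.

(** Opposite a zero pair the zero pair is a solution, and the exchange reproduces it, so uniqueness
    leaves no other. Hence S never relates a point of [calT] to one outside it. *)
Lemma S_eqs_nondegenerate (R : realType) (p e f x y z : R[i]) :
  S_eqs p e f x y z -> (e, f) = (0, 0) <-> (y, z) = (0, 0).
Proof.
move=> S; split=> -[E1 E2]; move: S; rewrite E1 E2.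
  have S0 : S_eqs p 0 0 p 0 (0 : R[i]) by split; ring.
  by move=> /(S_eqs_right_uniq S0)[] -[_ -> ->]; congr pair; ring.
have S0 : S_eqs x 0 0 x 0 (0 : R[i]) by split; ring.
by move=> /(S_eqs_left_uniq S0)[] -[_ -> ->].
Qed.

Lemma calS_multivalued (R : realType) :
  multivalued (fun t : C3 R => [set t' | calS R (t, t')]).
Proof.
move=> [[p e] f]; have [x [y [z S]]] := S_eqs_right_total p e f.
split; first by exists (x, y, z).
apply: (@sub_finite_set _ _ [set (x, y, z); (p - (y - z), y - z, - z)]); last exact: finite_set2.
by move=> [[x' y'] z'] /= /(S_eqs_right_uniq S).
Qed.

(** * Irreducibility of quadratic polynomials through their Hessians *)

Section Irreducible.
Variables (F : fieldType) (n : nat).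
Implicit Types (a b q : {mpoly F[n]}) (i j k : 'I_n).

Lemma mderiv_U i j : ('X_j : {mpoly F[n]})^`M(i) = (i == j)%:R.
Proof.
rewrite mderivX mnm1E eq_sym; case: eqP => [->|_]; last by rewrite scale0r.
by rewrite scale1r -[X in (X - _)%MM](addm0 U_(j)%MM) addmC addmK mpolyX0.
Qed.

Lemma mderiv_affine a i : (msize a <= 2)%N -> a^`M(i) = ((a^`M(i))@_0)%:MP.
Proof.
move=> sa; apply/mpolyP => m; rewrite mcoeffC eq_sym.
case: eqP => [->|m0]; first by rewrite mulr1.
rewrite mulr0 mcoeff_deriv memN_msupp_eq0 ?mul0rn//.
apply: msize_mdeg_ge; rewrite (leq_trans sa)// mdegD mdeg1.
by rewrite addn1 ltnS lt0n mdeg_eq0 eq_sym; apply/eqP => E; case: m0; rewrite E.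
Qed.

Lemma mderiv2_mul_affine a b i j : (msize a <= 2)%N -> (msize b <= 2)%N ->
  (a * b)^`M(i)^`M(j) =
  ((a^`M(i))@_0 * (b^`M(j))@_0 + (a^`M(j))@_0 * (b^`M(i))@_0)%:MP.
Proof.
move=> sa sb; rewrite mderivM mderivD.
rewrite (mderiv_affine i sa) (mderiv_affine i sb) !mderivM !mderivC.
rewrite (mderiv_affine j sa) (mderiv_affine j sb) !mpolyCK.
by rewrite mul0r mulr0 add0r addr0 mpolyCD !mpolyCM.
Qed.

Lemma mpoly_unit_msize a : (msize a == 1)%N -> a \is a GRing.unit.
Proof.
case/msize_poly1P => c c0 ->; apply/unitrP; exists c^-1%:MP.
by rewrite -!mpolyCM mulVf ?divff ?mpolyC1.
Qed.

(** By degree, two non-unit factors are both affine, and then [mderiv2_mul_affine] makes the Hessian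
    a symmetrized product of the two gradients. *)
Lemma irreducible_quadratic q : msize q = 3 ->
  (forall u v : 'I_n -> F, exists i j,
     q^`M(i)^`M(j) != (u i * v j + u j * v i)%:MP) ->
  irreducible_mpoly q.
Proof.
move=> sq qN; have q0 : q != 0 by rewrite -msize_poly_eq0 sq.
split=> //.
  apply/negP => /unitrP[r [rq _]]; have r0 : r != 0.
    by apply: contra_eq_neq rq => ->; rewrite mul0r eq_sym oner_eq0.
  move/(congr1 (fun p => msize p)): rq; rewrite msizeM // sq msize1.
  by rewrite (mpolySpred _ r0); lia.
move=> a b E; move: q0; rewrite E mulf_eq0 negb_or => /andP[a0 b0].
have [/eqP sa|sa] := eqVneq (msize a) 1%N; first by left; exact: mpoly_unit_msize.
have [/eqP sb|sb] := eqVneq (msize b) 1%N; first by right; exact: mpoly_unit_msize.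
have := sq; rewrite E msizeM //.
move: sa sb; rewrite (mpolySpred _ a0) (mpolySpred _ b0) !eqSS -!lt0n => sa sb sab.
have [sa2 sb2] : (msize a <= 2)%N /\ (msize b <= 2)%N.
  by rewrite (mpolySpred _ a0) (mpolySpred _ b0); split; lia.
have [i [j]] := qN (fun i => (a^`M(i))@_0) (fun i => (b^`M(i))@_0).
by rewrite E mderiv2_mul_affine // eqxx.
Qed.

End Irreducible.

Section DiagonalForm.
Variables (F : numFieldType) (n : nat) (i1 i2 i3 : 'I_n).
Hypotheses (n12 : i1 != i2) (n13 : i1 != i3) (n23 : i2 != i3).

Let ij := (negbTE n12, negbTE n13, negbTE n23, eq_sym i2 i1, eq_sym i3 i1, eq_sym i3 i2).

Definition diag_form : {mpoly F[n]} :=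
  'X_i1 ^+ 2 + 'X_i2 ^+ 2 + 2%:MP * 'X_i3 ^+ 2.

Lemma diag_formE (v : 'I_n -> F) :
  diag_form.@[v] = v i1 ^+ 2 + v i2 ^+ 2 + 2 * v i3 ^+ 2.
Proof. by rewrite !mevalD mevalM !expr2 !mevalM !mevalXU mevalC. Qed.

Lemma mderiv2_diag_form i j : diag_form^`M(i)^`M(j) =
  (2 * ((i == i1) && (j == i1))%:R + 2 * ((i == i2) && (j == i2))%:R
   + 4 * ((i == i3) && (j == i3))%:R)%:MP.
Proof.
have sq k : (('X_k ^+ 2 : {mpoly F[n]})^`M(i)^`M(j)) = (2 * ((i == k) && (j == k))%:R)%:MP.
  rewrite expr2 mderivM !mderiv_U mderivD !mderivM !mderiv_U.
  have c0 (b : bool) : (b%:R : {mpoly F[n]})^`M(j) = 0.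
    by case: b; rewrite ?mulr1n ?mulr0n ?mderiv0 // -mpolyC1 mderivC.
  rewrite c0 mul0r mulr0 add0r addr0 eq_sym (eq_sym j).
  by case: (k == i); case: (k == j);
     rewrite /= ?mulr1n ?mulr0n ?mulr1 ?mulr0 ?mul0r ?addr0 ?mpolyC0 ?mpolyC_nat.
by rewrite /diag_form !mderivD !mderiv_mulC !sq -mpolyCM -!mpolyCD; congr (_%:MP); ring.
Qed.

Lemma msize_diag_form : msize diag_form = 3.
Proof.
have q0 : diag_form != 0.
  apply/eqP => /(congr1 (meval (fun i => (i == i1)%:R))); rewrite diag_formE meval0.
  rewrite eqxx !ij expr1n expr0n mulr0 !addr0; exact/eqP/oner_neq0.
have hU i : ('X_i ^+ 2 : {mpoly F[n]}) \is 2.-homog.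
  by rewrite -[2%N]/(1 * 2)%N; apply: dhomogMn; rewrite dhomogX /= mdeg1.
have q2 : diag_form \is 2.-homog.
  rewrite /diag_form mul_mpolyC; apply: dhomogD; last exact: dhomogZ.
  exact: dhomogD.
by have := dhomog_uniq q0 (dhomog_msize q2) q2; rewrite (mpolySpred _ q0) => /= ->.
Qed.

(** The diagonal Hessian with entries 2, 2, 4 has rank 3, out of reach of a symmetrized product of
    two vectors; the contradiction is computed on its entries. *)
Lemma diag_form_irreducible : irreducible_mpoly diag_form.
Proof.
apply: irreducible_quadratic; first exact: msize_diag_form.
move=> u v; apply: contrapT => H.
have {}H i j : 2 * ((i == i1) && (j == i1))%:R + 2 * ((i == i2) && (j == i2))%:R
   + 4 * ((i == i3) && (j == i3))%:R = u i * v j + u j * v i.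
  apply: contrapT => /eqP N; apply: H; exists i, j.
  by rewrite mderiv2_diag_form mpolyC_eq.
have := (H i1 i1, H i2 i2, H i3 i3, (H i1 i2, H i1 i3, H i2 i3)).
rewrite !ij !eqxx /= !mulr0 !mulr1 !addr0 !add0r => {H}.
move: (u i1) (u i2) (u i3) (v i1) (v i2) (v i3) => a b c a' b' c'.
move=> [[[H11 H22] H33] [[H12 H13] H23]].
have n2 : (2 : F) != 0 by rewrite pnatr_eq0.
have aa : a * a' = 1 by apply: (mulfI n2); rewrite mulr1 [RHS]H11; ring.
have bb : b * b' = 1 by apply: (mulfI n2); rewrite mulr1 [RHS]H22; ring.
have cc : c * c' = 2 by apply: (mulfI n2); rewrite -natrM [RHS]H33; ring.
(* Multiplying the off-diagonal entry a b' + b a' = 0 by a b, then using [aa] and [bb], removes the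
   primed unknowns; likewise for the two other pairs. *)
have E12 : a ^+ 2 + b ^+ 2 = 0.
  have -> : a ^+ 2 + b ^+ 2 = a ^+ 2 * (b * b') + b ^+ 2 * (a * a') by rewrite aa bb !mulr1.
  by rewrite -[RHS](mulr0 (a * b)) H12; ring.
have E13 : 2 * a ^+ 2 + c ^+ 2 = 0.
  have -> : 2 * a ^+ 2 + c ^+ 2 = a ^+ 2 * (c * c') + c ^+ 2 * (a * a').
    by rewrite aa cc; ring.
  by rewrite -[RHS](mulr0 (a * c)) H13; ring.
have E23 : 2 * b ^+ 2 + c ^+ 2 = 0.
  have -> : 2 * b ^+ 2 + c ^+ 2 = b ^+ 2 * (c * c') + c ^+ 2 * (b * b').
    by rewrite bb cc; ring.
  by rewrite -[RHS](mulr0 (b * c)) H23; ring.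
have /eqP : 4 * a ^+ 2 = 0.
  have -> : 4 * a ^+ 2 = 2 * (a ^+ 2 + b ^+ 2) + (2 * a ^+ 2 + c ^+ 2)
    - (2 * b ^+ 2 + c ^+ 2) by ring.
  by rewrite E12 E13 E23; ring.
rewrite mulf_eq0 pnatr_eq0 /= sqrf_eq0 => /eqP a0.
by move/eqP: aa; rewrite a0 mul0r eq_sym oner_eq0.
Qed.

End DiagonalForm.

Section Quadric.
Variable R : realType.
Local Notation C := R[i].
Implicit Types (u v : 'rV[C]_4).

Let i1 : 'I_4 := inord 1.
Let i2 : 'I_4 := inord 2.
Let i3 : 'I_4 := inord 3.

(* In the coordinates g = (e - f)/2, h = (c - d)/2, s = (e + f)/2 with c = - y
   and d = z - y, the linear equation of S becomes c + d = - 2 s and the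
   quadratic one becomes g^2 + h^2 + 2 s^2 = 0. *)
Definition calS_param u : C3 R * C3 R :=
  let: (p, g, h, s) := (u 0 0, u 0 i1, u 0 i2, u 0 i3) in
  ((p, s + g, s - g), (p - s + h, s - h, - (h + h))).

(** The primed components come first so that they can be given explicitly in the linearity proof,
    where the right side is only convertible to them; [ring] then sees field expressions. *)
Lemma eq_pair6 (T : Type) (a' b' c' d' e' f' a b c d e f : T) :
  a = a' -> b = b' -> c = c' -> d = d' -> e = e' -> f = f' ->
  ((a, b, c), (d, e, f)) = ((a', b', c'), (d', e', f')).
Proof. by do 6!move=> ->. Qed.

Lemma calS_param_is_linear : linear calS_param.
Proof.
move=> k u v; rewrite /calS_param !mxE.
move: (u 0 0) (u 0 i1) (u 0 i2) (u 0 i3) (v 0 0) (v 0 i1) (v 0 i2) (v 0 i3).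
move=> p g h s p' g' h' s'; apply: (@eq_pair6 C
  (k * p + p') (k * (s + g) + (s' + g')) (k * (s - g) + (s' - g'))
  (k * (p - s + h) + (p' - s' + h')) (k * (s - h) + (s' - h'))
  (k * (- (h + h)) + - (h' + h'))); ring.
Qed.

HB.instance Definition _ := GRing.isLinear.Build C 'rV[C]_4 (C3 R * C3 R)%type
  *:%R calS_param calS_param_is_linear.

Lemma calS_param_inj : injective calS_param.
Proof.
move=> u v [Ep Esg Esg' _ Esh _].
have n2 : (2 : C) != 0 by rewrite pnatr_eq0.
have Es : u 0 i3 = v 0 i3.
  apply: (mulfI n2); have -> : 2 * u 0 i3 = (u 0 i3 + u 0 i1) + (u 0 i3 - u 0 i1) by ring.
  by rewrite Esg Esg'; ring.
have Eg : u 0 i1 = v 0 i1 by move: Esg; rewrite Es => /addrI.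
have Eh : u 0 i2 = v 0 i2 by move: Esh; rewrite Es => /addrI/oppr_inj.
apply/rowP => -[[|[|[|[|//]]]] lt4].
- by rewrite (_ : Ordinal lt4 = 0) //; apply: val_inj.
- by rewrite (_ : Ordinal lt4 = i1) //; apply: val_inj; rewrite /= inordK.
- by rewrite (_ : Ordinal lt4 = i2) //; apply: val_inj; rewrite /= inordK.
- by rewrite (_ : Ordinal lt4 = i3) //; apply: val_inj; rewrite /= inordK.
Qed.

Lemma calS_quadric : is_quadric 3 (calS R).
Proof.
exists calS_param, 0, (diag_form _ i1 i2 i3); split.
- exact: calS_param_inj.
- by apply: msize_diag_form; apply/eqP => /(congr1 val); rewrite /= !inordK.
- by apply: diag_form_irreducible; apply/eqP => /(congr1 val); rewrite /= !inordK.
apply/seteqP; split=> [[[[p e] f] [[x y] z]]|w [u]] /=; last first.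
  rewrite diag_formE add0r => E <-; rewrite /calS_param; split.
  - by ring.
  - by rewrite -[RHS](mulr0 2) -E; ring.
  - by ring.
move=> [E1 E2 E3].
have n2 : (2 : C) != 0 by rewrite pnatr_eq0.
(* These are p, g, h, s; here h = (c - d)/2 = - z/2. *)
exists (\row_i [:: p; (e - f) / 2; - z / 2; (e + f) / 2]`_i).
  rewrite diag_formE !mxE /= !inordK //=.
  apply: (mulfI n2); rewrite mulr0 -E2.
  have -> : z = 2 * y - e - f by apply/eqP; rewrite -subr_eq0 -E1; apply/eqP; ring.
  by field.
rewrite add0r /calS_param !mxE /= !inordK //=.
have Ez : z = 2 * y - e - f by apply/eqP; rewrite -subr_eq0 -E1; apply/eqP; ring.
have Ex : x = p - y by apply/eqP; rewrite -subr_eq0 -oppr_eq0 -E3; apply/eqP; ring.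
by congr (_, _, _, (_, _, _)); rewrite ?Ex ?Ez //; field.
Qed.

End Quadric.

(** * The correspondence on the projective line *)

Section Correspondence.
Variable R : realType.
Local Notation C := R[i].
Implicit Types (P Q : CP1 R) (t : calT R).

Definition biquadratic (e f y z : C) : C :=
  (2 * y - z) ^+ 2 * (e ^+ 2 + f ^+ 2) + (e + f) ^+ 2 * (y ^+ 2 + (z - y) ^+ 2).

Lemma S_eqs_biquadratic p e f x y z :
  S_eqs p e f x y z -> biquadratic e f y z = 0.
Proof.
move=> /S_eqs_split[E1 E2 _]; rewrite /biquadratic E1 E2.
by ring.
Qed.

Lemma biquadratic_homogeneous (k l e f y z : C) :
  biquadratic (k * e) (k * f) (l * y) (l * z) =
  k ^+ 2 * l ^+ 2 * biquadratic e f y z.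
Proof. by rewrite /biquadratic; ring. Qed.

(* The scalars th and mu are fixed up to a common factor by the linear
   equation, and free when its two sides vanish. *)
Lemma biquadratic_S_eqs (e f y z : C) : (e, f) <> (0, 0) -> (y, z) <> (0, 0) ->
  biquadratic e f y z = 0 ->
  exists th mu, [/\ th != 0, mu != 0 &
    S_eqs 0 (th * e) (th * f) (- (mu * y)) (mu * y) (mu * z)].
Proof.
move=> ef0 yz0 B; have n2 : (2 : C) != 0 by rewrite pnatr_eq0.
suff [th [mu [th0 mu0 E1 E2]]] : exists th mu : C, [/\ th != 0, mu != 0,
    th * (e + f) = mu * (2 * y - z) &
    th ^+ 2 * (e ^+ 2 + f ^+ 2) + mu ^+ 2 * (y ^+ 2 + (z - y) ^+ 2) = 0].
  exists th, mu; split=> //; split.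
  - have -> : th * e + th * f - mu * y + (- (mu * y) + mu * z) =
      th * (e + f) - mu * (2 * y - z) by ring.
    by rewrite E1 subrr.
  - by rewrite -[RHS]E2; ring.
  - by rewrite addNr subrr.
have [ef|ef] := eqVneq (e + f) 0; have [yz|yz] := eqVneq (2 * y - z) 0.
- have Ef : f = - e by apply/eqP; rewrite -addr_eq0 addrC ef.
  have Ez : z = 2 * y by apply/eqP; rewrite eq_sym -subr_eq0 yz.
  subst f z; have e0 : e != 0 by apply/eqP => e0; apply: ef0; rewrite e0 oppr0.
  have y0 : y != 0 by apply/eqP => y0; apply: yz0; rewrite y0 mulr0.
  (* With f = - e and z = 2 y the linear equation is trivial and the quadratic one reads 2 th^2 e^2
     + 2 mu^2 y^2 = 0. *)
  exists ('i * y), e; split=> //.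
  + by rewrite mulf_neq0 // neq0Ci.
  + by rewrite ef yz !mulr0.
  + by rewrite exprMn sqrCi; ring.
(* When exactly one side of the linear equation vanishes, the biquadratic forces the corresponding
   pair to be zero, which is excluded. *)
- move: B; rewrite /biquadratic ef expr0n mul0r addr0 => /eqP.
  have -> : f = - e by apply/eqP; rewrite -addr_eq0 addrC ef.
  have -> : e ^+ 2 + (- e) ^+ 2 = 2 * (e * e) by ring.
  rewrite !mulf_eq0 (negbTE yz) (negbTE n2) /= orbb => /eqP e0; case: ef0; rewrite e0; congr pair.
  by move: ef; rewrite e0 add0r.
- move: B; rewrite /biquadratic yz expr0n mul0r add0r => /eqP.
  have -> : z = 2 * y by apply/eqP; rewrite eq_sym -subr_eq0 yz.
  have -> : 2 * y - y = y by ring.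
  have -> : y ^+ 2 + y ^+ 2 = 2 * (y * y) by ring.
  rewrite !mulf_eq0 (negbTE ef) (negbTE n2) /= orbb => /eqP y0; case: yz0; rewrite y0; congr pair.
  by move: yz; rewrite y0 mulr0 sub0r => /eqP; rewrite oppr_eq0 => /eqP.
- exists (2 * y - z), (e + f); split=> //; first by ring.
Qed.

Lemma calT_exists (p e f : C) : (e, f) <> (0, 0) ->
  exists t, val t = (p, e, f).
Proof. by move=> ef0; exists (exist _ (p, e, f) (mem_set (ef0 : calT R (p, e, f)))). Qed.

Lemma calT_neq0 t p e f : val t = (p, e, f) -> (e, f) <> (0, 0).
Proof. by case: t => -[[p' e'] f'] /= /set_mem /= ef0 [_ <- <-]. Qed.

Lemma proj_homothety t t' (th p e f p' : C) : th != 0 ->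
  val t = (p, e, f) -> val t' = (p', th * e, th * f) -> proj t = proj t'.
Proof.
move=> th0 Et Et'; apply/proj_eqP; exists th, (p' - th * p); split=> //.
by rewrite Et Et' /= addrC subrK.
Qed.

Lemma proj_surj P : exists t, proj t = P.
Proof.
have P1 := valP P; set v := vpick (val P).
have v0 : v != 0.
  by rewrite vpick0; apply/eqP => P0; move: P1; rewrite P0 dimv0.
have [t Et] := @calT_exists 0 v.1 v.2 (fun E => negP v0 (introT eqP
  (etrans (surjective_pairing v) E))).
exists t; apply: val_inj => /=; apply/eqP; rewrite eqEdim (eqP P1).
rewrite dim_vline /dir Et /= -surjective_pairing v0 leqnn andbT.
by rewrite -memvE memv_pick.
Qed.

Lemma mem_proj t (p e f e' f' : C) : val t = (p, e, f) ->
  ((e', f') : C2 R) \in val (proj t) <-> exists k, e' = k * e /\ f' = k * f.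
Proof.
move=> Et; rewrite /= /dir Et /=; split=> [/vlineP[k [-> ->]]|[k [-> ->]]].
  by exists k.
by apply/vlineP; exists k.
Qed.

Lemma projSP P Q : projS R (P, Q) <-> exists t t' p e f x y z,
  [/\ proj t = P, proj t' = Q, val t = (p, e, f), val t' = (x, y, z)
    & S_eqs p e f x y z].
Proof.
split=> [[[t t'] /= S [<- <-]]|[t [t' [p [e [f [x [y [z [<- <- Et Et' S]]]]]]]]]].
  exists t, t'; case: (val t) S => -[p e] f; case: (val t') => -[x y] z S.
  by exists p, e, f, x, y, z.
by exists (t, t') => //=; rewrite Et Et'.
Qed.

Definition biquadratic_mpoly : {mpoly C[4]} :=
  let X k : {mpoly C[4]} := 'X_(inord k) in
  (2%:MP * X 2 - X 3) ^+ 2 * (X 0 ^+ 2 + X 1 ^+ 2) +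
  (X 0 + X 1) ^+ 2 * (X 2 ^+ 2 + (X 3 - X 2) ^+ 2).

Lemma eval4_biquadratic e f y z :
  eval4 biquadratic_mpoly e f y z = biquadratic e f y z.
Proof.
rewrite /eval4 /biquadratic_mpoly /biquadratic.
rewrite !(mevalD, mevalM, mevalN, expr2, mevalXU, mevalC) !inordK //=.
Qed.

Section PartialDegree.
Variables i j : 'I_4.
(** Registered below as a measure, so that closure properties of homogeneous polynomials give the
    bidegree without expanding [biquadratic_mpoly]. *)
Definition partial_degree (m : 'X_{1..4}) := (m i + m j)%N.

Lemma partial_degree0 : partial_degree 0%MM = 0%N.
Proof. by rewrite /partial_degree !mnm0E. Qed.

Lemma partial_degreeD : {morph partial_degree : m1 m2 / (m1 + m2)%MM >-> (m1 + m2)%N}.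
Proof. by move=> m1 m2; rewrite /partial_degree !mnmDE; lia. Qed.

HB.instance Definition _ :=
  isMeasure.Build 4 partial_degree partial_degree0 partial_degreeD.

Lemma homog_partial_degree k d : partial_degree U_(k)%MM = d ->
  ('X_k : {mpoly C[4]}) \is d.-homog for partial_degree.
Proof. by move=> E; rewrite dhomogX /= E. Qed.
End PartialDegree.

Lemma biquadratic_partial_degree i j (a b : nat) :
  partial_degree i j U_(inord 0)%MM = a -> partial_degree i j U_(inord 1)%MM = a ->
  partial_degree i j U_(inord 2)%MM = b -> partial_degree i j U_(inord 3)%MM = b ->
  biquadratic_mpoly \is (a * 2 + b * 2).-homog for (partial_degree i j).
Proof.
do 4!move=> /homog_partial_degree ?.
rewrite /biquadratic_mpoly mul_mpolyC; apply: dhomogD.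
  rewrite addnC; apply: dhomogM.
    by apply: dhomogMn; apply: rpredB => //; apply: dhomogZ.
  by apply: dhomogD; apply: dhomogMn.
apply: dhomogM; first by apply: dhomogMn; apply: dhomogD.
by apply: dhomogD; apply: dhomogMn; rewrite ?rpredB.
Qed.

Lemma biquadratic_bihomogeneous : bihomogeneous 2 2 biquadratic_mpoly.
Proof.
have E (k l : nat) : (k < 4)%N -> (l < 4)%N ->
    U_(inord k : 'I_4)%MM (inord l) = (k == l) :> nat.
  by move=> k4 l4; rewrite mnm1E -(inj_eq val_inj) /= !inordK.
by move=> m m_q; split; [have := @biquadratic_partial_degree (inord 0) (inord 1) 1 0
  | have := @biquadratic_partial_degree (inord 2) (inord 3) 0 1];
  rewrite /partial_degree !E // => /(_ erefl erefl erefl erefl)/dhomogP/(_ m m_q).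
Qed.

Lemma projS_correspondence : correspondence (projS R).
Proof.
split.
- exists 2, 2, biquadratic_mpoly; split=> //.
  + apply/eqP => /(congr1 (fun q => eval4 q 1 0 0 1)); rewrite eval4_biquadratic.
    rewrite /eval4 meval0 /biquadratic.
    have -> : (2 * 0 - 1) ^+ 2 * (1 ^+ 2 + 0 ^+ 2) +
      (1 + 0) ^+ 2 * (0 ^+ 2 + (1 - 0) ^+ 2) = 2 :> C by ring.
    by move/eqP; rewrite pnatr_eq0.
  + exact: biquadratic_bihomogeneous.
  move=> P Q; split=> [/projSP|B].
    move=> [t [t' [p [e [f [x [y [z [<- <- Et Et' S]]]]]]]]] e' f' y' z'.
    move=> /(mem_proj _ _ Et)[k [-> ->]] /(mem_proj _ _ Et')[l [-> ->]].
    by rewrite eval4_biquadratic biquadratic_homogeneous (S_eqs_biquadratic S) mulr0.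
  have [t Pt] := proj_surj P; have [t' Qt'] := proj_surj Q.
  case Et : (val t) => [[p e] f]; case Et' : (val t') => [[x y] z].
  have ef0 := calT_neq0 Et; have yz0 := calT_neq0 Et'.
  (* The chosen representatives satisfy S only after rescaling by th and mu, which does not move P
     and Q. *)
  have /(biquadratic_S_eqs ef0 yz0)[th [mu [th0 mu0 S]]] : biquadratic e f y z = 0.
    rewrite -eval4_biquadratic; apply: B; rewrite -?Pt -?Qt'.
      by apply/(mem_proj _ _ Et); exists 1; rewrite !mul1r.
    by apply/(mem_proj _ _ Et'); exists 1; rewrite !mul1r.
  have nz (k a b : C) : k != 0 -> (a, b) <> (0, 0) -> (k * a, k * b) <> (0, 0).
    move=> k0 ab [/eqP Ea /eqP Eb]; move: Ea Eb; rewrite !mulf_eq0 (negbTE k0) /=.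
    by move=> /eqP Ea /eqP Eb; apply: ab; rewrite Ea Eb.
  have [s Es] := calT_exists 0 (nz _ _ _ th0 ef0).
  have [s' Es'] := calT_exists (- (mu * y)) (nz _ _ _ mu0 yz0).
  apply/projSP; exists s, s', 0, (th * e), (th * f), (- (mu * y)), (mu * y), (mu * z).
  split=> //; first by rewrite -Pt (proj_homothety th0 Et Es).
  by rewrite -Qt' (proj_homothety mu0 Et' Es').
- move=> P; have [t <-] := proj_surj P; case Et : (val t) => [[p e] f].
  have [x [y [z S]]] := S_eqs_right_total p e f.
  have yz0 : (y, z) <> (0, 0).
    by move/(S_eqs_nondegenerate S); exact: calT_neq0 Et.
  have [t1 E1] := calT_exists x yz0.
  have [t2 E2] : exists t, val t = (p - (y - z), y - z, - z).
    apply: calT_exists => -[/eqP + /eqP]; rewrite oppr_eq0 subr_eq0 => /eqP yz /eqP z0.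
    by apply: yz0; rewrite yz z0.
  split.
    by exists (proj t1); apply/projSP; exists t, t1, p, e, f, x, y, z.
  apply: (@sub_finite_set _ _ [set proj t1; proj t2]); last exact: finite_set2.
  move=> Q /projSP[s [s' [p0 [e0 [f0 [x' [y' [z' [Ps <- Es Es' S']]]]]]]]].
  (* A similarity carries s to t and preserves S, so it carries s' to one of the two solutions
     opposite t, up to its position. *)
  have /proj_eqP[th [ta [th0 Ets]]] := Ps.
  move: Ets; rewrite Et Es /= => -[Ep Ee Ef].
  have /(S_eqs_right_uniq S) : S_eqs p e f (th * x' + ta) (th * y') (th * z').
    by rewrite Ep Ee Ef; apply: S_eqs_translate; exact: S_eqs_homothety.
  move=> -[] [Ex Ey Ez]; [left|right]; apply: (proj_homothety th0 Es').
    by rewrite E1 Ey Ez.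
  by rewrite E2 Ey Ez.
- move=> Q; have [t <-] := proj_surj Q; case Et : (val t) => [[x y] z].
  have [e [f S]] := S_eqs_left_total x y z.
  have ef0 : (e, f) <> (0, 0).
    by move/(S_eqs_nondegenerate S); exact: calT_neq0 Et.
  have fe0 : (f, e) <> (0, 0) by move=> [f0 e0]; apply: ef0; rewrite f0 e0.
  have [t1 E1] := calT_exists (x + y) ef0.
  have [t2 E2] := calT_exists (x + y) fe0.
  split.
    by exists (proj t1); apply/projSP; exists t1, t, (x + y), e, f, x, y, z.
  apply: (@sub_finite_set _ _ [set proj t1; proj t2]); last exact: finite_set2.
  move=> P /projSP[s [s' [p0 [e0 [f0 [x' [y' [z' [<- Qs Es Es' S']]]]]]]]].
  have /proj_eqP[th [ta [th0 Ets]]] := Qs.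
  move: Ets; rewrite Et Es' /= => -[Ex Ey Ez].
  have /(S_eqs_left_uniq S) : S_eqs (th * p0 + ta) (th * e0) (th * f0) x y z.
    by rewrite Ex Ey Ez; apply: S_eqs_translate; exact: S_eqs_homothety.
  move=> -[] [Ep Ee Ef]; [left|right]; apply: (proj_homothety th0 Es).
    by rewrite E1 Ee Ef.
  by rewrite E2 Ee Ef.
Qed.

End Correspondence.

(** * Rooted trees *)

Section Trees.
Variable T : graph.
Implicit Types (r t u v w x y : T) (p q s : seq T).

Lemma path_rev_adj x p : path adj x p ->
  path adj (last x p) (rev (belast x p)) /\ last (last x p) (rev (belast x p)) = x.
Proof.
move=> xp; split; last by case/lastP: p {xp} => //= p y; rewrite belast_rcons rev_cons last_rcons.
by rewrite rev_path (eq_path (e' := adj)) // => a b; rewrite adj_sym.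
Qed.

Lemma acyclic_last_adj x a p : acyclic T -> adj x a -> path adj a p ->
  uniq [:: x, a & p] -> adj (last a p) x -> last a p = a.
Proof.
move=> acT xa ap U lx; have : ucycle adj [:: x, a & p].
  by rewrite /ucycle U andbT /= rcons_path xa ap.
by move/acT; case: p {ap U lx}.
Qed.

(* Two simple paths leaving x through a and b form a walk from a to b that
   avoids x, hence a cycle through x unless a = b. *)
Lemma acyclic_upath_inj x p q : acyclic T ->
  path adj x p -> path adj x q -> uniq (x :: p) -> uniq (x :: q) ->
  last x p = last x q -> p = q.
Proof.
move=> acT; elim: p x q => [|a p IH] x [|b q] //=.
- by move=> _ _ _ /andP[xbq _] E; move: xbq; rewrite E mem_last.
- by move=> _ _ /andP[xap _] _ E; move: xap; rewrite -E mem_last.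
move=> /andP[xa ap] /andP[xb bq] /andP[xNap Uap] /andP[xNbq Ubq] E.
suff ab : a = b by rewrite -ab in bq Ubq E *; rewrite (IH a q).
have [rbq lbq] := path_rev_adj bq.
pose w := p ++ rev (belast b q).
have aw : path adj a w by rewrite cat_path ap E.
have lw : last a w = b by rewrite last_cat E.
have xNw : x \notin a :: w.
  rewrite -cat_cons mem_cat negb_or xNap mem_rev.
  by apply: contra xNbq; exact: mem_belast.
case: (shortenP aw) lw => w' aw' Uw' sw lw.
rewrite -lw; symmetry; apply: (acyclic_last_adj acT xa aw').
  rewrite cons_uniq Uw' andbT; apply: contra xNw; rewrite !inE.
  by case/orP=> [->//|/sw ->]; rewrite orbT.
by rewrite lw adj_sym.
Qed.

End Trees.

Definition star (T : graph) (t : T) (s : seq T) := uniq s /\ adj t =i s.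

(** The orientation of a tree away from r; depth supports induction, and the value [par r] is
    junk. *)
Definition rooted (T : graph) (r : T) (par : T -> T) (dep : T -> nat) :=
  [/\ forall t, dep t = 0%N -> t = r,
      dep r = 0%N,
      forall t, t <> r -> adj (par t) t /\ dep t = (dep (par t)).+1
    & forall u v, adj u v -> (v <> r /\ u = par v) \/ (u <> r /\ v = par u)].

Definition child (T : graph) (r : T) (par : T -> T) (t w : T) := w <> r /\ t = par w.

(** The simple path from r to t is unique; its length is the depth of t and its penultimate vertex
    the parent. *)
Lemma rooted_exists (T : graph) (r : T) : tree T ->
  exists par dep, @rooted T r par dep.
Proof.
move=> [_ conT acT].
have /choice[P HP] t : exists p, [/\ path adj r p, uniq (r :: p) & last r p = t].
  have [p [rp <-]] := conT r t.
  by have [p' rp' Up' _] := shortenP rp; exists p'.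
have PP t : path adj r (P t) by case: (HP t).
have PU t : uniq (r :: P t) by case: (HP t).
have PL t : last r (P t) = t by case: (HP t).
have PE t p : path adj r p -> uniq (r :: p) -> last r p = t -> P t = p.
  by move=> rp Up lp; apply: (acyclic_upath_inj acT (PP t) rp) => //; rewrite PL.
have Pr : P r = [::] by apply: PE.
have Pcons u v : adj u v -> v \notin r :: P u -> P v = rcons (P u) v.
  move=> uv vNu; apply: PE; last by rewrite last_rcons.
    by rewrite rcons_path PP PL.
  by rewrite -rcons_cons rcons_uniq vNu PU.
pose par t := last r (belast r (P t)).
have parE t p : P t = rcons p t -> par t = last r p by rewrite /par => ->; rewrite belast_rcons.
exists par, (fun t => size (P t)); split=> [t /size0nil Pt||t tr|u v uv].
- by rewrite -[t]PL Pt.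
- by rewrite Pr.
- have [p Ep] : exists p, P t = rcons p t.
    have := PL t; case/lastP: (P t) => [rt|p x]; first by case: tr.
    by rewrite last_rcons => ->; exists p.
  have := PP t; have := PU t; rewrite Ep rcons_path -rcons_cons rcons_uniq.
  move=> /andP[_ Up] /andP[rp pt]; rewrite (parE _ _ Ep); split=> //.
  by rewrite (PE (last r p) p) // size_rcons.
(* If v is off the path to u, that path extends to v. Otherwise the path to v is an initial part of
   it that misses u, and the roles are exchanged. *)
- have [vu|vNu] := boolP (v \in r :: P u); last first.
    left; split; first by move=> vr; move: vNu; rewrite vr mem_head.
    by rewrite (parE _ (P u)) ?PL // (Pcons u).
  right; have uNv : u \notin r :: P v.
    have := PP u; have := PU u; have := PL u; case/splitPl: vu => p1 p2 l1.
    rewrite cat_path -cat_cons cat_uniq last_cat l1.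
    move=> l2 /and3P[U1 /hasPn N2 _] /andP[rp1 vp2].
    rewrite (PE v p1) //; case: p2 l2 N2 {vp2} => [uv'|b p2 <- N2 /=].
      by move: uv; rewrite -uv' adj_irrefl.
    by apply: N2; exact: mem_last.
  have vu' : adj v u by rewrite adj_sym.
  split; first by move=> ur; move: uNv; rewrite ur mem_head.
  by rewrite (parE _ (P v)) ?PL // (Pcons v).
Qed.

Section Rooted.
Variables (T : graph) (r : T) (par : T -> T) (dep : T -> nat).
Hypothesis rT : rooted r par dep.
Local Notation child := (child r par).
Implicit Types (t u v w : T).

Lemma child_adj t w : child t w -> adj t w.
Proof. by case: rT => _ _ + _ [wr ->] => /(_ w wr)[]. Qed.

Lemma child_dep t w : child t w -> dep w = (dep t).+1.
Proof. by case: rT => _ _ + _ [wr ->] => /(_ w wr)[]. Qed.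

Lemma adj_child u v : adj u v -> child u v \/ child v u.
Proof. by case: rT => _ _ _; apply. Qed.

Lemma rooted_ind (P : T -> Prop) : P r ->
  (forall t w, child t w -> P t -> P w) -> forall t, P t.
Proof.
move=> Pr Pc t; have [n] := ubnP (dep t); elim: n t => // n IH t tn.
case: (eqVneq t r) => [->//|/eqP tr].
have tc : child (par t) t by [].
by apply: (Pc _ _ tc); apply: IH; rewrite -ltnS -(child_dep tc).
Qed.

(* Dependent choice along the tree. *)
Lemma rooted_rec (X : Type) (Q : T -> X -> Prop)
    (N : T -> X -> T -> X -> Prop) (x0 : X) :
  Q r x0 ->
  (forall t x w, Q t x -> child t w -> exists y, Q w y /\ N t x w y) ->
  exists st : T -> X, [/\ st r = x0, forall t, Q t (st t)
    & forall t w, child t w -> N t (st t) w (st w)].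
Proof.
move=> Q0 step.
have /choice[Y HY] : forall a : T * X * T, exists y : X,
    Q a.1.1 a.1.2 -> child a.1.1 a.2 -> Q a.2 y /\ N a.1.1 a.1.2 a.2 y.
  move=> [[t x] w] /=; have [[Qt tw]|H] := pselect (Q t x /\ child t w).
    by have [y Hy] := step _ _ _ Qt tw; exists y.
  by exists x0 => Qt tw; case: H.
(* The counter n is fuel: the depth of t is exactly the number of steps up to the root. *)
pose go := fix go n t := if n is n'.+1 then Y (par t, go n' (par t), t) else x0.
pose st t := go (dep t) t.
have stE t w : child t w -> st w = Y (t, st t, w).
  by move=> tw; rewrite /st (child_dep tw) /= -tw.2.
have str : st r = x0 by case: rT => _ r0 _ _; rewrite /st r0.
have Qst : forall t, Q t (st t).
  apply: rooted_ind => [|t w tw Qt]; first by rewrite str.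
  by rewrite (stE _ _ tw); case: (HY (t, st t, w) Qt tw).
exists st; split=> // t w tw.
by rewrite (stE _ _ tw); case: (HY (t, st t, w) (Qst t) tw).
Qed.

End Rooted.

Section Regular.
Variable T : graph.
Hypothesis hT : is_T3 T.
Implicit Types (r t u v w a b c : T) (s : seq T).

Lemma star_exists t : exists a b c, star t [:: a; b; c].
Proof.
case: hT => _ /(_ t) t3.
have ft : finite_set (nbrs t) by apply/finite_setP; exists 3%N.
pose s : seq T := enum_fset (fset_set (nbrs t)).
have s3 : size s = 3 := card_fset_set t3.
have Us : uniq s by exact: fset_uniq.
have Hs : adj t =i s.
  move=> x; rewrite -[x \in s]/(x \in fset_set (nbrs t)) in_fset_set //.
  by apply/idP/idP => [H|/set_mem //]; exact: mem_set.
by case: s s3 Us Hs => [|a [|b [|c [|]]]] // _ Us Hs; exists a, b, c; split.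
Qed.

Lemma star_at t a : adj t a -> exists b c, star t [:: a; b; c].
Proof.
have [x [y [z [U H]]]] := star_exists t.
rewrite -[adj t a]/(a \in adj t) H !inE => /or3P[]/eqP->.
- by exists y, z.
- exists x, z; split.
    by rewrite (perm_uniq (s2 := [:: x; y; z])) // (perm_catCA [:: y] [:: x] [:: z]).
  by move=> u; rewrite H !inE orbCA.
- exists x, y; split.
    by rewrite (perm_uniq (s2 := [:: x; y; z])) // -(perm_catC [:: x; y] [:: z]).
  by move=> u; rewrite H !inE orbA orbC.
Qed.

Lemma star_perm t s s' : star t s -> star t s' -> perm_eq s s'.
Proof.
by move=> [U H] [U' H']; apply: uniq_perm => // x; rewrite -H H'.
Qed.

Lemma star_adj t s a : star t s -> a \in s -> adj t a.
Proof. by move=> [_ H]; rewrite -H. Qed.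

Lemma starP t s : uniq s -> size s = 3 -> {in s, forall a, adj t a} -> star t s.
Proof.
move=> Us s3 st; have [a [b [c [U H]]]] := star_exists t.
split=> // x; rewrite H.
have sub : {subset s <= [:: a; b; c]}.
  by move=> y /st; rewrite -[adj t y]/(y \in adj t) H.
by have [|_ ->] := uniq_min_size Us sub; rewrite ?s3.
Qed.

(** Reduces claims on all markings of a star with a given first edge to one marking and its
    exchange. *)
Lemma star_tail t a b c b' c' : star t [:: a; b; c] -> star t [:: a; b'; c'] ->
  (b', c') = (b, c) \/ (b', c') = (c, b).
Proof.
move=> S S'; have := star_perm S S'; rewrite perm_cons => P.
have := perm_mem P b'; have := perm_mem P c'; rewrite !inE !eqxx orbT /=.
case: S' => /= /and3P[_ + _] _; rewrite inE.
move=> N /orP[]/eqP E /orP[]/eqP E'; subst; rewrite ?eqxx // in N *; by [left|right].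
Qed.

End Regular.

(** * The dual graph *)

(* ed u v has a junk value when u and v are not adjacent. *)
Lemma edge_exists (T : graph) : is_T3 T -> exists ed : T -> T -> dual_graph T,
  forall u v, adj u v -> val (ed u v : edges T) = [set u; v].
Proof.
move=> hT; have [r] : inhabited T by case: hT => -[].
have [a [b [c S]]] := star_exists hT r.
have ra : adj r a by apply: star_adj S _; rewrite mem_head.
suff /choice[ed edE] : forall uv : T * T, exists E : dual_graph T,
    adj uv.1 uv.2 -> val (E : edges T) = [set uv.1; uv.2].
  by exists (fun u v => ed (u, v)) => u v uv; exact: (edE (u, v)) uv.
have mk u v : adj u v -> exists E : dual_graph T, val (E : edges T) = [set u; v].
  move=> uv; have uvP : edges T [set u; v] by exists u, v.
  by exists (exist _ [set u; v] (mem_set uvP)).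
move=> [u v] /=; have [uv|nuv] := boolP (adj u v).
  by have [E EE] := mk _ _ uv; exists E.
by have [E _] := mk _ _ ra; exists E => uv; case/negP: nuv.
Qed.

Lemma uniq4 (X : eqType) (x1 x2 x3 x4 : X) : x1 <> x2 -> x1 <> x3 -> x1 <> x4 ->
  x2 <> x3 -> x2 <> x4 -> x3 <> x4 -> uniq [:: x1; x2; x3; x4].
Proof. by do 6!move/eqP => ?; rewrite /= !inE !negb_or; do !(apply/andP; split). Qed.

Lemma uniq4_neq (X : eqType) (x1 x2 x3 x4 : X) : uniq [:: x1; x2; x3; x4] ->
  [/\ x1 <> x3, x1 <> x4, x2 <> x3 & x2 <> x4].
Proof.
by rewrite /= !inE !negb_or => /and4P[/and3P[_ /eqP ? /eqP ?] /andP[/eqP ? /eqP ?] _ _].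
Qed.

Section DualGraph.
Variable T : graph.
Hypothesis hT : is_T3 T.
Local Notation Tr3 := (dual_graph T).
Variable ed : T -> T -> Tr3.
Hypothesis edE : forall u v, adj u v -> val (ed u v : edges T) = [set u; v].
Implicit Types (r t u v w a b c d n m : T) (E O A B C D : Tr3).

Lemma adj_neq u v : adj u v -> u <> v.
Proof. by move=> uv E; move: uv; rewrite E adj_irrefl. Qed.

Lemma edge_sym u v : adj u v -> ed u v = ed v u.
Proof.
move=> uv; apply: val_inj; have vu : adj v u by rewrite adj_sym.
by rewrite [LHS](edE uv) [RHS](edE vu) setUC.
Qed.

Lemma edge_surj E : exists u v, adj u v /\ E = ed u v.
Proof.
have [u [v [uv EE]]] := set_mem (valP E); exists u, v; split=> //.
by apply: val_inj; rewrite [RHS](edE uv).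
Qed.

Lemma edge_endpoint u v t : adj u v -> val (ed u v : edges T) t <-> t = u \/ t = v.
Proof. by move=> uv; rewrite (edE uv). Qed.

Lemma edge_inj u v u' v' : adj u v -> adj u' v' -> ed u v = ed u' v' ->
  (u' = u /\ v' = v) \/ (u' = v /\ v' = u).
Proof.
move=> uv uv' E.
have u'E : u' = u \/ u' = v by apply/(edge_endpoint _ uv); rewrite E; apply/edge_endpoint; auto.
have v'E : v' = u \/ v' = v by apply/(edge_endpoint _ uv); rewrite E; apply/edge_endpoint; auto.
have := adj_neq uv'.
by case: u'E v'E => -> [] -> ?; auto.
Qed.

Lemma edge_injr t a b : adj t a -> adj t b -> ed t a = ed t b -> a = b.
Proof.
by move=> ta tb /(edge_inj ta tb)[[_ ->]|[ta' _]] //; case: (adj_neq ta).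
Qed.

Lemma no_triangle u v n : adj u v -> adj u n -> adj v n -> False.
Proof.
move=> uv un vn; have [[_ _ acT] _] := hT.
suff /acT : ucycle adj [:: u; v; n] by [].
rewrite /ucycle /= uv vn adj_sym un /= !inE negb_or andbT.
by apply/andP; split; first (apply/andP; split); apply/eqP; apply: adj_neq.
Qed.

Lemma adj_edge_at t a b : adj t a -> adj t b -> a <> b -> adj (ed t a) (ed t b).
Proof.
move=> ta tb ab; apply/andP; split; first by apply/eqP => /(edge_injr ta tb).
by apply/asboolP; exists t; split; apply/edge_endpoint => //; left.
Qed.

Lemma adj_edge u v E : adj u v -> adj (ed u v) E ->
  (exists n, [/\ adj u n, n <> v & E = ed u n]) \/
  (exists n, [/\ adj v n, n <> u & E = ed v n]).
Proof.
move=> uv /andP[/eqP N /asboolP[x []]].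
have [a [b [ab EE]]] := edge_surj E; rewrite EE in N *.
have ba : adj b a by rewrite adj_sym.
case/(edge_endpoint _ uv) => -> /(edge_endpoint _ ab)[] xE; subst.
- by left; exists b; split=> // bv; apply: N; rewrite bv.
- left; exists a; split=> //; last exact: edge_sym.
  by move=> av; apply: N; rewrite -av edge_sym.
- right; exists b; split=> // bu; apply: N; rewrite -bu; exact: edge_sym.
- right; exists a; split=> //; last exact: edge_sym.
  by move=> au; apply: N; rewrite au.
Qed.

Lemma star3_neq t a b c : star t [:: a; b; c] -> [/\ a <> b, a <> c & b <> c].
Proof.
by case=> /= /and3P[]; rewrite !inE negb_or => /andP[/eqP ? /eqP ?] /eqP ? _ _.
Qed.

Lemma star3_adj t a b c : star t [:: a; b; c] -> [/\ adj t a, adj t b & adj t c].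
Proof. by move=> S; split; apply: star_adj S _; rewrite !inE eqxx ?orbT. Qed.

Lemma star_triangle t a b c : star t [:: a; b; c] ->
  triangle (ed t a) (ed t b) (ed t c).
Proof.
by move=> S; have [ab ac bc] := star3_neq S; have [ta tb tc] := star3_adj S;
   split; apply: adj_edge_at.
Qed.

(** Three pairwise meeting edges share a vertex or form a 3-cycle, and a tree has none. *)
Lemma triangle_star O A B : triangle O A B -> exists t a b c,
  star t [:: a; b; c] /\ [/\ O = ed t a, A = ed t b & B = ed t c].
Proof.
move=> [OA OB AB]; have [u [v [uv Ouv]]] := edge_surj O.
wlog [n [un nv An]] : u v uv Ouv / exists n, [/\ adj u n, n <> v & A = ed u n].
  move=> W; have := OA; rewrite {1}Ouv => /(adj_edge uv)[|] H; first exact: (W u v).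
  by apply: (W v u); rewrite 1?adj_sym // Ouv; exact: edge_sym.
exists u, v, n; have := OB; rewrite {1}Ouv => /(adj_edge uv)[] [m [um mv Bm]]; last first.
  have /(adj_edge un) : adj (ed u n) B by rewrite -An.
  have mv' : adj m v by rewrite adj_sym.
  case=> -[k [uk kn]]; rewrite Bm => /(edge_inj um uk).
    by case=> -[ku kv]; [case: (adj_neq uv)|case: mv].
  case=> -[ku kv]; first by case: nv.
  by subst m; case: (no_triangle uv un um).
exists m; split=> //; apply: starP => //.
- rewrite /= !inE negb_or andbT; apply/andP; split; first (apply/andP; split); apply/eqP.
  + by move/esym.
  + by move/esym.
  + by move=> nm; move: AB; rewrite An Bm nm adj_irrefl.
- by move=> x; rewrite !inE => /or3P[]/eqP->.
Qed.

(** The set depends on t alone, not on the marking; this tells whether two triangles are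
    distinct. *)
Lemma star_triangle_set t a b c : star t [:: a; b; c] ->
  [set ed t a; ed t b; ed t c] = [set E | val (E : edges T) t].
Proof.
move=> S; have [ta tb tc] := star3_adj S; apply/seteqP; split=> E /=.
  by move=> [[]|] ->; apply/edge_endpoint => //; left.
have [u [v [uv ->]]] := edge_surj E; have vu : adj v u by rewrite adj_sym.
case: S => _ H; case/(edge_endpoint _ uv) => tE; subst.
  have : v \in adj u by [].
  by rewrite H !inE => /or3P[]/eqP ->; [left; left|left; right|right].
have : u \in adj v by [].
by rewrite edge_sym // H !inE => /or3P[]/eqP ->; [left; left|left; right|right].
Qed.

Lemma edge_star t w : adj t w -> exists a b c d,
  star t [:: w; a; b] /\ star w [:: t; c; d].
Proof.
move=> tw; have [a [b Sa]] := star_at hT tw.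
have [|c [d Sc]] := @star_at _ hT w t; first by rewrite adj_sym.
by exists a, b, c, d.
Qed.

Lemma star_adjacent t w a b c d : star t [:: w; a; b] -> star w [:: t; c; d] ->
  adjacent_triangles (ed t w) (ed t a) (ed t b) (ed w c) (ed w d).
Proof.
move=> St Sw; have [tw ta tb] := star3_adj St; have [wt wc wd] := star3_adj Sw.
have [wa wb ab] := star3_neq St.
split; first exact: star_triangle; first by rewrite edge_sym //; exact: star_triangle.
rewrite (star_triangle_set St) edge_sym // (star_triangle_set Sw) => H.
have : [set E | val (E : edges T) w] (ed t a).
  by rewrite -H /=; apply/edge_endpoint => //; left.
by move=> /(edge_endpoint _ ta)[wt'|//]; exact: adj_neq wt (wt').
Qed.

Lemma adjacent_star O A B C D : adjacent_triangles O A B C D -> exists t w a b c d,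
  [/\ star t [:: w; a; b], star w [:: t; c; d], O = ed t w
    & [/\ A = ed t a, B = ed t b, C = ed w c & D = ed w d]].
Proof.
move=> [/triangle_star[t [w [a [b [St [EO EA EB]]]]]]].
move=> /triangle_star[t' [w' [c [d [Sw [EO' EC ED]]]]]] N.
have [tw ta tb] := star3_adj St; have [tw' _ _] := star3_adj Sw.
have := EO; rewrite {1}EO' => /(edge_inj tw' tw)[[? ?]|[? ?]]; subst t' w'.
  case: N; rewrite {1}EO EA EB {1}EO' EC ED.
  by rewrite (star_triangle_set St) (star_triangle_set Sw).
by exists t, w, a, b, c, d.
Qed.

(** Turns the outcome of a recursion on T, a function of a vertex and a neighbour, into a function
    on edges. *)
Lemma edge_lift (X : Type) (f : T -> T -> X) :
  (forall u v, adj u v -> f u v = f v u) ->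
  exists phi : Tr3 -> X, forall u v, adj u v -> phi (ed u v) = f u v.
Proof.
move=> fC.
have /choice[phi H] E : exists y, forall u v, adj u v -> E = ed u v -> y = f u v.
  have [u [v [uv ->]]] := edge_surj E; exists (f u v) => u' v' uv'.
  by move=> /(edge_inj uv uv')[[-> ->]|[-> ->]] //; exact: fC.
by exists phi => u v uv; exact: H.
Qed.

Lemma nbrs_edge t w a b c d : star t [:: w; a; b] -> star w [:: t; c; d] ->
  uniq [:: ed t a; ed t b; ed w c; ed w d] /\
  nbrs (ed t w) = [set` [:: ed t a; ed t b; ed w c; ed w d]].
Proof.
move=> St Sw; have [tw ta tb] := star3_adj St; have [wt wc wd] := star3_adj Sw.
have [wa wb ab] := star3_neq St; have [nc nd cd] := star3_neq Sw.
have X x y : adj t x -> adj w y -> w <> x -> ed t x <> ed w y.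
  by move=> tx wy wx /(edge_inj tx wy)[[/(adj_neq wt)]|[]].
split.
  by apply: uniq4; [move/(edge_injr ta tb)|exact: X|exact: X|exact: X|exact: X
    |move/(edge_injr wc wd)].
have nbr (x y : T) s : star x s -> adj x y -> y \in s by case=> _ <-.
apply/seteqP; split=> E; rewrite -[[set` _] E]/(is_true (E \in _)) !in_cons in_nil orbF.
  move=> /(adj_edge tw)[] [n [/nbr + nN ->]].
    by move=> /(_ _ St); rewrite !inE => /or3P[]/eqP E' //; rewrite E' eqxx ?orbT.
  by move=> /(_ _ Sw); rewrite !inE => /or3P[]/eqP E' //; rewrite E' eqxx ?orbT.
rewrite /nbrs -[[set y | _] E]/(is_true (adj _ E)).
by case/or4P => /eqP ->; rewrite ?(edge_sym tw); try (by apply: adj_edge_at);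
  rewrite -(edge_sym tw); apply: adj_edge_at.
Qed.

Definition edge_compatible (R : realType) (phi : Tr3 -> R[i]) :=
  forall t w a b c d, star t [:: w; a; b] -> star w [:: t; c; d] ->
  compatible (phi (ed t w)) (phi (ed t a)) (phi (ed t b)) (phi (ed w c)) (phi (ed w d)).

(** The explicit list of four neighbours unfolds the Laplacian, and its leading factor cancels
    because it is nonzero. *)
Lemma holomorphic_edge (R : realType) (phi : Tr3 -> R[i]) :
  holomorphic phi <-> edge_compatible phi.
Proof.
have lapE (f : Tr3 -> R[i]) t w a b c d :
    star t [:: w; a; b] -> star w [:: t; c; d] ->
    laplacian f (ed t w) = 0 <-> (f (ed t a) - f (ed t w)) + (f (ed t b) - f (ed t w)) +
     ((f (ed w c) - f (ed t w)) + (f (ed w d) - f (ed t w))) = 0.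
  move=> St Sw; have [U E] := nbrs_edge St Sw.
  have val0 : (valency (ed t w))%:R^-1 != 0 :> R[i].
    rewrite invr_eq0 pnatr_eq0 /valency cardfs_eq0; apply/eqP => N0.
    have : ed t a \in fset_set (nbrs (ed t w)).
      by rewrite E in_fset_set ?finite_seq //; apply: mem_set; rewrite /= mem_head.
    by rewrite N0 in_fset0.
  rewrite /laplacian E -fsbig_seq // !big_cons big_nil /=.
  rewrite (addr0 (f (ed w d) - f (ed t w))) addrA.
  split=> [/eqP|->]; last by rewrite mulr0.
  by rewrite mulf_eq0 (negbTE val0) => /eqP.
split=> [[H1 H2] t w a b c d St Sw|H].
  apply/compatible_laplace; split.
    exact: (lapE _ _ _ _ _ _ _ St Sw).1 (H1 _).
  exact: (lapE _ _ _ _ _ _ _ St Sw).1 (H2 _).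
split=> E; have [t [w [tw ->]]] := edge_surj E;
  have [a [b [c [d [St Sw]]]]] := edge_star tw; apply/(lapE _ _ _ _ _ _ _ St Sw).
  by case: (H _ _ _ _ _ _ St Sw).
by have /compatible_laplace[] := H _ _ _ _ _ _ St Sw.
Qed.

End DualGraph.

(** * Extension of holomorphic functions *)

Section Extensions.
Variables (R : realType) (T : graph).
Hypothesis hT : is_T3 T.
Local Notation Tr3 := (dual_graph T).
Local Notation C := R[i].
Variable ed : T -> T -> Tr3.
Hypothesis edE : forall u v, adj u v -> val (ed u v : edges T) = [set u; v].
Implicit Types (t u w : T) (phi : Tr3 -> C) (F G : Tr3 -> option C).

Lemma extension_step_mono F F' x v :
  extension_step F F' -> F x = Some v -> F' x = Some v.
Proof.
move=> [O [A [B [C0 [D [o [a [b [c [d [_ _ [FC FD] _ ->]]]]]]]]]]] Fx.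
by case: eqP => [E|_]; [rewrite E FC in Fx|case: eqP => [E|//]; rewrite E FD in Fx].
Qed.

Lemma extension_run_mono O A B (o a b : C) (F : nat -> Tr3 -> option C) m n x v :
  extension_run O A B o a b F -> (m <= n)%N -> F m x = Some v -> F n x = Some v.
Proof.
move=> [_ run]; elim: n => [|n IH]; first by rewrite leqn0 => /eqP->.
rewrite leq_eqVlt => /orP[/eqP->//|/IH{}IH /IH Fx].
by case: (run n) => [->//|/extension_step_mono]; apply.
Qed.

Section Coherence.
Variables (r : T) (par : T -> T) (dep : T -> nat).
Hypothesis rT : rooted r par dep.
Local Notation child := (child r par).

(* The domains met in the extension process: with an edge that is a child
   edge of w they contain the triangle at w and the one at the parent of w. *)
Definition coherent G := forall t w w1, child t w -> child w w1 ->
  G (ed w w1) <> None -> exists a b c d o va vb vc vd,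
  [/\ star t [:: w; a; b], star w [:: t; c; d], compatible o va vb vc vd,
      [/\ G (ed t w) = Some o, G (ed t a) = Some va & G (ed t b) = Some vb]
    & G (ed w c) = Some vc /\ G (ed w d) = Some vd].

Lemma coherent_initial u1 u2 u3 (o a b : C) G : star r [:: u1; u2; u3] ->
  initial (ed r u1) (ed r u2) (ed r u3) o a b G -> coherent G.
Proof.
move=> /star3_adj[r1 r2 r3] I t w w1 tw ww1.
have N u : adj r u -> ed w w1 <> ed r u.
  move=> ru /esym/(edge_inj edE ru (child_adj rT ww1))[[wr _]|[_ wr]].
    by case: tw.
  by case: ww1.
by rewrite I; do 3!case: eqP => [/N//|_].
Qed.

Lemma other_child t w c : child t w -> adj w c -> c <> t -> child w c.
Proof. by move=> tw wc ct; case: (adj_child rT wc) => // -[_ cE]; case: ct; rewrite cE tw.2. Qed.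

Lemma coherent_step F F' : coherent F -> extension_step F F' -> coherent F'.
Proof.
move=> cF step; have mono := extension_step_mono step.
case: step => O [A [B [C0 [D [o [va [vb [vc [vd [adjT FE [FC FD] S F'E]]]]]]]]]].
have [t0 [w0 [a [b [c [d [St Sw EO [EA EB EC ED]]]]]]]] := adjacent_star hT edE adjT.
have [tw ta tb] := star3_adj St; have [wt wc wd] := star3_adj Sw.
have [tc td _] := star3_neq Sw; have [wa _ _] := star3_neq St.
(* The step goes downwards: were w0 the parent of t0, the edge A would be a child edge of t0, and
   coherence would already have defined C and D. *)
have tw0 : child t0 w0.
  case: (adj_child rT tw) => // wt0.
  have [] := cF _ _ _ wt0 (other_child wt0 ta (nesym wa)).
    by rewrite -EA; case: FE => _ -> _.
  move=> c' [d' [? [? [? [? [? [? [? [Sw' _ _ [_ Ec' Ed'] _]]]]]]]]].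
  by case: (star_tail Sw Sw') => -[Ec Ed]; subst c' d'; move: Ec' Ed'; rewrite -EC -ED FC ?FD.
move=> t w w1 tw' ww1; have ww1' := child_adj rT ww1.
(* Data for an old edge persist by monotonicity; [new] treats the two edges just added, whose data
   come from the step itself. *)
suff new e : adj w0 e -> e <> t0 -> ed w w1 = ed w0 e ->
    exists a b c d o va vb vc vd,
  [/\ star t [:: w; a; b], star w [:: t; c; d], compatible o va vb vc vd,
      [/\ F' (ed t w) = Some o, F' (ed t a) = Some va & F' (ed t b) = Some vb]
    & F' (ed w c) = Some vc /\ F' (ed w d) = Some vd].
  rewrite F'E; case: eqP => [E _|_]; first by apply: (new c) => //; [exact: nesym|rewrite E].
  case: eqP => [E _|_]; first by apply: (new d) => //; [exact: nesym|rewrite E].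
  move/(cF _ _ _ tw' ww1) => [a' [b' [c' [d' [? [? [? [? [? [S1 S2 S3 [E1 E2 E3] [E4 E5]]]]]]]]]]].
  exists a', b', c', d'; do 5!eexists; split; [exact: S1|exact: S2|exact: S3| |];
    by split; apply: mono; eassumption.
move=> we et E.
have [wE w1E] : w = w0 /\ w1 = e.
  have [[]//|[wE w1E]] := edge_inj edE we ww1' (esym E).
  by case: et; rewrite -wE ww1.2 w1E -tw0.2.
have tE : t = t0 by rewrite tw'.2 wE -tw0.2.
subst t w; exists a, b, c, d, o, va, vb, vc, vd.
case: FE => FO FA FB; split=> //.
- exact/S_eqs_compatible.
- by split; apply: mono; rewrite -?EO -?EA -?EB.
split; first by rewrite F'E EC eqxx.
rewrite F'E ED eqxx EC; case: eqP => // /(edge_injr edE wd wc) dc.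
by case: (star3_neq Sw) => _ _ /(_ (esym dc)).
Qed.

Lemma coherent_extends G : coherent G ->
  exists phi, edge_compatible ed phi /\ forall x v, G x = Some v -> phi x = v.
Proof.
move=> cG.
(* The state at t gives the values on the edges at t. [Q] says that it extends G, and [N] that
   neighbouring states agree on their common edge and are compatible there. *)
pose Q t (h : T -> C) := forall n v, adj t n -> G (ed t n) = Some v -> h n = v.
pose N t (h : T -> C) w (h' : T -> C) := h' t = h w /\
  forall a b c d, star t [:: w; a; b] -> star w [:: t; c; d] ->
  compatible (h w) (h a) (h b) (h' c) (h' d).
(* The root triangle is unconstrained, so 0 fills the values missing from G. *)
have [||st [_ stQ stN]] := rooted_rec rT (Q := Q) (N := N)
    (x0 := fun n => odflt 0 (G (ed r n))).
- by move=> n v _ ->.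
- move=> t h w Qt tw.
  have tw' := child_adj rT tw; have wt' : adj w t by rewrite adj_sym.
  have [a [b [c [d [St Sw]]]]] := edge_star hT tw'.
  have Nsuff h' x y z k : star t [:: w; x; y] -> star w [:: t; z; k] -> h' t = h w ->
      compatible (h w) (h x) (h y) (h' z) (h' k) -> N t h w h'.
    move=> S S' E K; split=> // x1 y1 z1 k1 S1 S1'.
    have [[-> ->]|[-> ->]] := star_tail S S1; have [[-> ->]|[-> ->]] := star_tail S' S1' => //.
    - exact: compatible_swapr.
    - exact: compatible_swapl.
    - exact/compatible_swapl/compatible_swapr.
  have Qsuff h' : h' t = h w ->
     (forall n v, child w n -> G (ed w n) = Some v -> h' n = v) -> Q w h'.
    move=> E K n v wn Gn; have [nt|/eqP nt] := eqVneq n t.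
      by rewrite nt in Gn *; rewrite E; apply: Qt => //; rewrite (edge_sym edE).
    by apply: K => //; exact: other_child tw wn nt.
  have [tc td cd] := star3_neq Sw.
  (* If one child edge of w is in the domain, coherence supplies both, with compatible values;
     otherwise both values are chosen freely. *)
  have [[w1 [ww1 Gw1]]|noG] := pselect (exists w1, child w w1 /\ G (ed w w1) <> None).
    pose h' n := if n == t then h w else odflt 0 (G (ed w n)).
    have h't : h' t = h w by rewrite /h' eqxx.
    exists h'; split.
      apply: Qsuff => // n v wn Gn; rewrite /h' Gn; case: eqP => // nt.
      by have := child_dep rT wn; rewrite nt (child_dep rT tw); lia.
    have [a1 [b1 [c1 [d1 [o [va [vb [vc [vd [St1 Sw1 K [G1 G2 G3] [G4 G5]]]]]]]]]]] :=
      cG _ _ _ tw ww1 Gw1.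
    have [_ ta tb] := star3_adj St1; have [_ wc wd] := star3_adj Sw1.
    have [tc1 td1 _] := star3_neq Sw1.
    have K1 : compatible (h w) (h a1) (h b1) (h' c1) (h' d1).
      rewrite (Qt _ _ tw' G1) (Qt _ _ ta G2) (Qt _ _ tb G3) /h' G4 G5.
      by do 2!(case: eqP => [/esym//|_]).
    exact: Nsuff St1 Sw1 h't K1.
  have [c0 [d0 K]] := compatible_exists (h w) (h a) (h b).
  pose h' n := if n == t then h w else if n == c then c0 else d0.
  have h't : h' t = h w by rewrite /h' eqxx.
  exists h'; split.
    by apply: Qsuff => // n v wn Gn; case: noG; exists n; rewrite Gn.
  by apply: (Nsuff _ _ _ _ _ St Sw) => //; rewrite /h' eqxx; do 3!(case: eqP => [/esym//|_]).
have stC u v : adj u v -> st u v = st v u.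
  by move=> /(adj_child rT)[] /stN[-> _].
have [phi phiE] := edge_lift edE stC.
exists phi; split.
  move=> t w a b c d St Sw.
  have [tw ta tb] := star3_adj St; have [wt wc wd] := star3_adj Sw.
  rewrite !phiE //; case: (adj_child rT tw) => /stN[E K]; first exact: K.
  by rewrite E; apply: compatible_flip; apply: K.
move=> x v; have [u [w [uw ->]]] := edge_surj edE x.
by move=> Gx; rewrite phiE //; apply: (stQ u).
Qed.

End Coherence.

(** A run is increasing, so its stages have a union G. Each instance of coherence involves a single
    stage, hence passes to G, which then extends even if it is not total. *)
Lemma extension_run_holomorphic O A B (o a b : C) (F : nat -> Tr3 -> option C) :
  triangle O A B -> extension_run O A B o a b F ->
  exists phi, holomorphic phi /\ run_limit F phi.
Proof.
move=> /(triangle_star hT edE)[r [u1 [u2 [u3 [Sr [-> -> ->]]]]]] run.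
have [par [dep rT]] := rooted_exists r hT.1.
have cF n : coherent r par (F n).
  elim: n => [|n IH]; first exact: (coherent_initial rT Sr run.1).
  by case: (run.2 n) => [->|] //; exact: (coherent_step rT IH).
have /choice[G HG] x : exists g, (forall n v, F n x = Some v -> g = Some v) /\
    (g <> None -> exists n, F n x <> None).
  have [[n [v Fn]]|noF] := pselect (exists n v, F n x = Some v).
    exists (Some v); split; last by move=> _; exists n; rewrite Fn.
    move=> m v' Fm; case: (leqP m n) => [mn|/ltnW nm].
      by rewrite -(extension_run_mono run mn Fm).
    by rewrite -Fm (extension_run_mono run nm Fn).
  by exists None; split=> // n v Fn; case: noF; exists n, v.
have cG : coherent r par G.
  move=> t w w1 tw ww1 /(HG _).2[n /(cF n _ _ _ tw ww1)].
  move=> [a' [b' [c' [d' [? [? [? [? [? [S1 S2 S3 [E1 E2 E3] [E4 E5]]]]]]]]]]].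
  exists a', b', c', d'; do 5!eexists; split; [exact: S1|exact: S2|exact: S3| |];
    by split; apply: (HG _).1; eassumption.
have [phi [K phiG]] := coherent_extends rT cG.
exists phi; split; first exact/(holomorphic_edge hT edE).
by move=> n x v /(HG x).1/phiG.
Qed.

Lemma holomorphic_calS phi : holomorphic phi <->
  forall O A B C0 D, adjacent_triangles O A B C0 D ->
    calS R ((phi O, phi A - phi O, phi B - phi O),
            (phi C0, phi O - phi C0, phi D - phi C0)).
Proof.
split=> [/(holomorphic_edge hT edE) K O A B C0 D|H].
  move=> /(adjacent_star hT edE)[t [w [a [b [c [d [St Sw -> [-> -> -> ->]]]]]]]].
  exact/S_eqs_compatible/K.
apply/(holomorphic_edge hT edE) => t w a b c d St Sw.
by apply/S_eqs_compatible/H; exact: star_adjacent.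
Qed.

Lemma initial_exists (O A B : Tr3) (o a b : C) : exists F, initial O A B o a b F.
Proof.
by exists (fun x => if x == O then Some o else if x == A then Some a
                    else if x == B then Some b else None).
Qed.

Lemma initial_values (O A B : Tr3) (o a b : C) F : triangle O A B ->
  initial O A B o a b F -> [/\ F O = Some o, F A = Some a & F B = Some b].
Proof.
move=> [OA OB AB] I; rewrite !I !eqxx.
have neq (x y : Tr3) : adj x y -> y == x = false.
  by move=> xy; apply/eqP => E; move: xy; rewrite E adj_irrefl.
by rewrite (neq _ _ OA) (neq _ _ OB) (neq _ _ AB).
Qed.

(** Apply the previous result to the run that stays at the initial triangle. *)
Lemma holomorphic_extension O A B (o a b : C) : triangle O A B ->
  exists phi, [/\ holomorphic phi, phi O = o, phi A = a & phi B = b].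
Proof.
move=> tOAB; have [F I] := initial_exists O A B o a b.
have [|phi [hphi lim]] := @extension_run_holomorphic _ _ _ o a b (fun=> F) tOAB.
  by split=> // n; left.
have [FO FA FB] := initial_values tOAB I.
by exists phi; split; rewrite // (lim 0%N _ _ FO, lim 0%N _ _ FA, lim 0%N _ _ FB).
Qed.

(** Uniqueness comes from [compatible_uniq]; either order of the two values is realized by a run
    with a single step. *)
Lemma holomorphic_extension_step O A B C0 D (o a b : C) :
  adjacent_triangles O A B C0 D -> exists c d, forall c' d',
    (exists phi, [/\ holomorphic phi, [/\ phi O = o, phi A = a & phi B = b],
                     phi C0 = c' & phi D = d']) <->
    (c', d') = (c, d) \/ (c', d') = (d, c).
Proof.
move=> adjT; have [c [d K]] := compatible_exists o a b; exists c, d => c' d'.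
split=> [[phi [/holomorphic_calS/(_ _ _ _ _ _ adjT)/S_eqs_compatible K' [EO EA EB] EC ED]]|E].
  by rewrite EO EA EB EC ED in K'; exact: compatible_uniq K K'.
have {}K : compatible o a b c' d'.
  by case: E => -[-> ->] //; exact: compatible_swapr.
have [tOAB [OC OD CD] neqT] := adjT.
have [F0 I] := initial_exists O A B o a b.
have [FO FA FB] := initial_values tOAB I.
pose F1 x := if x == C0 then Some c' else if x == D then Some d' else F0 x.
have [|phi [hphi lim]] := @extension_run_holomorphic _ _ _ o a b
    (fun n => if n is 0%N then F0 else F1) tOAB.
  split=> // -[|n]; last by left.
  right; exists O, A, B, C0, D, o, a, b, c', d'; split=> //; last exact/S_eqs_compatible.
  have [t [w [a1 [b1 [c1 [d1 [St Sw EO [EA EB EC ED]]]]]]]] := adjacent_star hT edE adjT.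
  have [U _] := nbrs_edge edE St Sw.
  have [AC AD BC BD] := uniq4_neq U.
  rewrite -?EA -?EB -?EC -?ED in AC AD BC BD.
  have nOC : C0 <> O by move=> E'; move: OC; rewrite E' adj_irrefl.
  have nOD : D <> O by move=> E'; move: OD; rewrite E' adj_irrefl.
  rewrite !I; split.
    by case: eqP => // _; case: eqP => [/esym//|_]; case: eqP => [/esym//|_].
  by case: eqP => // _; case: eqP => [/esym//|_]; case: eqP => [/esym//|_].
exists phi; split=> //.
- by split; [exact: (lim 0%N _ _ FO)|exact: (lim 0%N _ _ FA)|exact: (lim 0%N _ _ FB)].
- by apply: (lim 1%N); rewrite /F1 eqxx.
- apply: (lim 1%N); rewrite /F1 eqxx; case: eqP => // DC.
  by move: CD; rewrite DC adj_irrefl.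
Qed.

End Extensions.

(** * Every holomorphic function is produced by the process *)

Section ExhaustiveRun.
Variables (R : realType) (T : graph).
Hypothesis hT : is_T3 T.
Local Notation Tr3 := (dual_graph T).
Variable ed : T -> T -> Tr3.
Hypothesis edE : forall u v, adj u v -> val (ed u v : edges T) = [set u; v].
Implicit Types (t u v w : T).

Lemma T3_enumeration (r : T) : exists e : nat -> T, forall t n, exists2 m, (n <= m)%N & e m = t.
Proof.
have /choice[nb nbP] u : exists f : nat -> T, forall v, adj u v -> exists i, f i = v.
  have [a [b [c [_ H]]]] := star_exists hT u; exists (nth a [:: a; b; c]) => v uv.
  have : v \in adj u by [].
  by rewrite H => vs; exists (index v [:: a; b; c]); rewrite nth_index.
(* A coded list is a walk from r, each entry selecting a neighbour. Its head is dropped: this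
   padding makes the code as large as wanted, so every vertex recurs. *)
exists (fun n => foldl nb r (behead (CodeSeq.decode n))) => t n.
have [[_ conT _] _] := hT; have [p [rp <-]] := conT r t.
have [s Es] : exists s, foldl nb r s = last r p.
  elim: p r rp {t} => [|v p IH] r /=; first by exists [::].
  by case/andP=> /(nbP r)[i Ei] /IH[s Es]; exists (i :: s); rewrite /= Ei.
exists (CodeSeq.code (n :: s)); last by rewrite CodeSeq.codeK.
by have /allP/(_ n (mem_head _ _))/ltnW := CodeSeq.ltn_code (n :: s).
Qed.

(* The enumeration e takes every value infinitely often, so each vertex comes up
   again after its parent has been processed. *)
Fixpoint processed (par : T -> T) (e : nat -> T) (r : T) (n : nat) : set T :=
  if n is m.+1 then
    [set t | processed par e r m t \/ (t = e m /\ processed par e r m (par t))]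
  else [set r].

Lemma exhaustive_run (O A B : Tr3) (phi : Tr3 -> R[i]) :
  triangle O A B -> holomorphic phi ->
  exists F : nat -> Tr3 -> option R[i],
    [/\ extension_run O A B (phi O) (phi A) (phi B) F, exhaustive F & run_limit F phi].
Proof.
move=> /(triangle_star hT edE)[r [u1 [u2 [u3 [Sr [-> -> ->]]]]]].
move=> /(holomorphic_edge hT edE) K.
have [par [dep rT]] := rooted_exists r hT.1.
have [e eP] := T3_enumeration r.
pose V := processed par e r.
have VS n t : V n t -> V n.+1 t by left.
have Vr n : V n r by elim: n => [//|n]; exact: VS.
have Vle m n t : (m <= n)%N -> V m t -> V n t.
  elim: n => [|n IH]; first by rewrite leqn0 => /eqP->.
  by rewrite leq_eqVlt => /orP[/eqP->//|/IH{}IH /IH]; exact: VS.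
have Vpar n t w : child r par t w -> V n w -> V n t.
  move=> [wr ->]; elim: n => [|n IH]; first by move/wr.
  by case=> [/IH|[_]]; left.
have Vall t : exists n, V n t.
  elim/(rooted_ind rT): t => [|t w [wr tw] [n Vt]]; first by exists 0%N.
  have [m nm em] := eP w n; exists m.+1; right; split=> //.
  by rewrite -tw; exact: Vle Vt.
(* Stage n is phi restricted to the triangles at the processed vertices. *)
pose D n x := exists2 t, V n t & val (x : edges T) t.
pose F n x := if pselect (D n x) then Some (phi x) else None.
have FS n x : D n x -> F n x = Some (phi x) by rewrite /F; case: pselect.
have FN n x : ~ D n x -> F n x = None by rewrite /F; case: pselect.
have Sd n t a : V n t -> adj t a -> D n (ed t a).
  by move=> Vt ta; exists t => //; apply/(edge_endpoint edE) => //; left.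
exists F; split.
- split=> [x|n].
    have D0 y : D 0%N y <-> [set ed r u1; ed r u2; ed r u3] y.
      rewrite (star_triangle_set edE Sr); split=> [[t ->]|yr] //.
      by exists r.
    case: eqP => [->|?]; first by apply/FS/D0; left; left.
    case: eqP => [->|?]; first by apply/FS/D0; left; right.
    case: eqP => [->|?]; first by apply/FS/D0; right.
    by apply: FN => /D0[[]|].
  have [VE|[wV tV]] : V n.+1 = V n \/ ~ V n (e n) /\ V n (par (e n)).
    have [H|/not_implyP[tV wV]] := pselect (V n (par (e n)) -> V n (e n)); last by right.
    left; apply/seteqP; split=> t; last exact: VS.
    by case=> // -[-> /H].
  - by left; rewrite /F /D VE.
  right; set w := e n in wV tV; set t := par w in tV.
  have tw : child r par t w by split=> // wr; apply: wV; rewrite wr.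
  have tw' := child_adj rT tw.
  have [a [b [c [d [St Sw]]]]] := edge_star hT tw'.
  have [_ ta tb] := star3_adj St; have [_ wc wd] := star3_adj Sw.
  have [tc td cd] := star3_neq Sw.
  (* Processed vertices are closed under parents, so no child of the unprocessed w is processed and
     its child edges are still undefined. *)
  have noD x : adj w x -> x <> t -> ~ D n (ed w x).
    move=> wx xt [y Vy /(edge_endpoint edE _ wx)[] yE]; first by rewrite yE in Vy.
    have /(Vpar n) wxV := other_child rT tw wx xt.
    by apply: wV; apply: wxV; rewrite -yE.
  have Vw : V n.+1 w by right.
  exists (ed t w), (ed t a), (ed t b), (ed w c), (ed w d),
    (phi (ed t w)), (phi (ed t a)), (phi (ed t b)), (phi (ed w c)), (phi (ed w d)).
  split.
  - exact: star_adjacent.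
  - by rewrite !FS //; apply: Sd.
  - by split; apply/FN/noD => //; exact: nesym.
  - exact/S_eqs_compatible/K.
  move=> x; case: eqP => [->|xC]; first by apply/FS/Sd.
  case: eqP => [->|xD]; first by apply/FS/Sd.
  (* Apart from its two child edges, the triangle at w has only the edge to t, already in the
     domain. *)
  suff E : D n.+1 x <-> D n x.
    have [H|H] := pselect (D n x); first by rewrite !FS //; apply/E.
    by rewrite !FN // => /E.
  split=> [[y []]|[y Vy xy]]; last by exists y => //; exact: VS.
    by move=> Vy xy; exists y.
  move=> [yw _]; rewrite yw -/w => xw; have := star_triangle_set edE Sw.
  move/seteqP => -[_ /(_ x xw)] [[|]|] //= ->.
  by rewrite -(edge_sym edE tw'); exact: Sd.
- move=> x; have [u [v [uv ->]]] := edge_surj edE x.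
  by have [n Vu] := Vall u; exists n; rewrite FS //; exact: Sd.
- by move=> n x v; rewrite /F; case: pselect => // _ [].
Qed.

End ExhaustiveRun.

(** * The action of the automorphism group *)

Section Matching.
Variables (R : realType) (T : graph).
Hypothesis hT : is_T3 T.
Local Notation Tr3 := (dual_graph T).
Local Notation C := R[i].
Variable ed : T -> T -> Tr3.
Hypothesis edE : forall u v, adj u v -> val (ed u v : edges T) = [set u; v].
Implicit Types (r t u v w a b c d n : T) (s : seq T) (phi : Tr3 -> C).

Lemma perm_star t s s' : perm_eq s s' -> star t s -> star t s'.
Proof. by move=> P [U H]; split; [rewrite -(perm_uniq P)|move=> x; rewrite H (perm_mem P)]. Qed.

Lemma edge_map (G : T -> T) : injective G -> (forall u v, adj u v -> adj (G u) (G v)) ->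
  exists g : Tr3 -> Tr3, (forall u v, adj u v -> g (ed u v) = ed (G u) (G v)) /\
    forall x y, adj x y -> adj (g x) (g y).
Proof.
move=> Ginj Gadj; have GC u v : adj u v -> ed (G u) (G v) = ed (G v) (G u).
  by move=> uv; apply: edge_sym => //; exact: Gadj.
have [g gE] := edge_lift edE GC; exists g; split=> // x y.
have H t a b : adj t a -> adj t b -> a <> b -> adj (g (ed t a)) (g (ed t b)).
  move=> ta tb ab; rewrite !gE //; apply: adj_edge_at => //; try exact: Gadj.
  by move/Ginj.
have [u [v [uv ->]]] := edge_surj edE x; have vu : adj v u by rewrite adj_sym.
case/(adj_edge edE uv) => -[n [un nv ->]]; first exact: (H _ _ _ _ _ (nesym nv)).
by rewrite (edge_sym edE uv); apply: (H _ _ _ _ _ (nesym nv)).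
Qed.

Lemma local_isomorphism_adj (G : T -> T) : injective G ->
  (forall t s, star t s -> star (G t) (map G s)) ->
  forall u v, adj (G u) (G v) -> adj u v.
Proof.
move=> Ginj Gstar u v; have [a [b [c S]]] := star_exists hT u.
move=> uv; have [_ H] := Gstar _ _ S.
have : G v \in adj (G u) by [].
by rewrite H => /mapP[n ns /Ginj ->]; exact: star_adj ns.
Qed.

(** Mapping stars onto stars makes G reflect adjacency, so its inverse induces a map on edges
    too. *)
Lemma local_isomorphism_automorphism (G Gi : T -> T) : cancel G Gi -> cancel Gi G ->
  (forall t s, star t s -> star (G t) (map G s)) ->
  exists g : Tr3 -> Tr3, is_aut g /\ forall u v, adj u v -> g (ed u v) = ed (G u) (G v).
Proof.
move=> GK GiK Gstar; have Ginj := can_inj GK.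
have Gadj u v : adj u v -> adj (G u) (G v).
  move=> uv; have [b [c S]] := star_at hT uv.
  by apply: star_adj (Gstar _ _ S) _; exact: mem_head.
have Giadj u v : adj u v -> adj (Gi u) (Gi v).
  by move=> uv; apply: (local_isomorphism_adj Ginj Gstar); rewrite !GiK.
have [g [gE gadj]] := edge_map Ginj Gadj.
have [gi [giE giadj]] := edge_map (can_inj GiK) Giadj.
have gK : cancel g gi.
  move=> x; have [u [v [uv ->]]] := edge_surj edE x.
  by rewrite gE // giE ?GK //; exact: Gadj.
have giK : cancel gi g.
  move=> x; have [u [v [uv ->]]] := edge_surj edE x.
  by rewrite giE // gE ?GiK //; exact: Giadj.
exists g; split=> //; split; first by exists gi.
by move=> x y; apply/idP/idP => [/giadj|]; [rewrite !gK|exact: gadj].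
Qed.

(** The matching goes by position and not by value, as phi may take equal values on two edges of the
    star. *)
Lemma star_match_exists phi phi' t t' a b c a' b' c' :
  star t [:: a; b; c] -> star t' [:: a'; b'; c'] ->
  phi (ed t a) = phi' (ed t' a') -> phi (ed t b) = phi' (ed t' b') ->
  phi (ed t c) = phi' (ed t' c') ->
  exists h : T -> T, [/\ h a = a', forall s, star t s -> star t' (map h s)
    & forall n, adj t n -> phi (ed t n) = phi' (ed t' (h n))].
Proof.
move=> S S' Ea Eb Ec; have [ab ac bc] := star3_neq S.
pose h n := if n == a then a' else if n == b then b' else c'.
have ha : h a = a' by rewrite /h eqxx.
have hb : h b = b' by rewrite /h eqxx; case: eqP => // /esym.
have hc : h c = c' by rewrite /h; do 2!(case: eqP => [/esym//|_]).
exists h; split=> // [s Ss|n tn].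
  apply: perm_star S'; rewrite -ha -hb -hc -[[:: h a; _; _]]/(map h [:: a; b; c]).
  by apply: perm_map; exact: star_perm S Ss.
have : n \in adj t by [].
by case: S => _ ->; rewrite !inE => /or3P[]/eqP ->; rewrite ?ha ?hb ?hc.
Qed.

(* The tree isomorphism is built along the tree, matching at each vertex the
   values of phi and phi'; the state at t is the image of t, and the map
   induced on the neighbours of t. *)
Lemma star_match_aut phi phi' r r' u1 u2 u3 v1 v2 v3 :
  edge_compatible ed phi -> edge_compatible ed phi' ->
  star r [:: u1; u2; u3] -> star r' [:: v1; v2; v3] ->
  phi (ed r u1) = phi' (ed r' v1) -> phi (ed r u2) = phi' (ed r' v2) ->
  phi (ed r u3) = phi' (ed r' v3) ->
  exists g : Tr3 -> Tr3, is_aut g /\ phi = phi' \o g.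
Proof.
move=> K K' Sr Sr' E1 E2 E3.
have [par [dep rT]] := rooted_exists r hT.1.
have [par' [dep' rT']] := rooted_exists r' hT.1.
have [h0 [_ h0S h0E]] := star_match_exists Sr Sr' E1 E2 E3.
pose Q t (x : T * (T -> T)) := (forall s, star t s -> star x.1 (map x.2 s)) /\
  forall n, adj t n -> phi (ed t n) = phi' (ed x.1 (x.2 n)).
pose N t (x : T * (T -> T)) w (y : T * (T -> T)) := y.1 = x.2 w /\ y.2 t = x.1.
have [||st [str stQ stN]] := rooted_rec rT (Q := Q) (N := N) (x0 := (r', h0)).
- by [].
- move=> t [t' h] w [/= hS hE] /(child_adj rT) tw.
  have wt : adj w t by rewrite adj_sym.
  have [a [b [c [d [St Sw]]]]] := edge_star hT tw.
  have St' := hS _ St; have [tw' ta' tb'] := star3_adj St'.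
  have wt' : adj (h w) t' by rewrite adj_sym.
  have [c' [d' Sw']] := star_at hT wt'.
  have [_ ta tb] := star3_adj St.
  have := K _ _ _ _ _ _ St Sw; rewrite (hE w) // (hE a) // (hE b) // => Ko.
  have Et : phi (ed w t) = phi' (ed (h w) t').
    by rewrite -(edge_sym edE tw) -(edge_sym edE tw') hE.
  (* The values on the two edges below w are determined up to exchange, so one of the two pairings
     matches them. *)
  have [] := compatible_uniq (K' _ _ _ _ _ _ St' Sw') Ko => -[Ec Ed].
    have [h' [h't h'S h'E]] := star_match_exists Sw Sw' Et Ec Ed.
    by exists (h w, h'); split.
  have Sw2 : star (h w) [:: t'; d'; c'].
    by apply: perm_star Sw'; rewrite perm_cons; exact: (permEl (perm_catC [:: c'] [:: d'])).
  have [h' [h't h'S h'E]] := star_match_exists Sw Sw2 Et Ec Ed.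
  by exists (h w, h'); split.
pose G t := (st t).1.
have hG t n : adj t n -> (st t).2 n = G n.
  by move=> /(adj_child rT)[] /stN[].
have Gstar t s : star t s -> star (G t) (map G s).
  move=> S; have -> : map G s = map (st t).2 s.
    by apply/eq_in_map => n ns; rewrite hG //; exact: star_adj S ns.
  exact: (stQ t).1 S.
have Gphi t n : adj t n -> phi (ed t n) = phi' (ed (G t) (G n)).
  by move=> tn; rewrite -(hG t n tn); exact: (stQ t).2.
have Gadj u v : adj u v -> adj (G u) (G v).
  move=> uv; have [b [c S]] := star_at hT uv.
  by apply: star_adj (Gstar _ _ S) _; exact: mem_head.
have Gloc t a b : adj t a -> adj t b -> G a = G b -> a = b.
  move=> ta tb E; have [c [d S]] := star_at hT ta.
  have [N1 N2 _] := star3_neq (Gstar _ _ S).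
  have : b \in adj t by [].
  by case: S => _ ->; rewrite !inE => /or3P[]/eqP bE //; rewrite bE in E.
have Gr : G r = r' by rewrite /G str.
(* Otherwise G w would be the parent of G t, which by induction is also G (par t); local injectivity
   would give w = par t, against the depths. *)
have Gchild w : forall t, child r par t w -> child r' par' (G t) (G w).
  elim/(rooted_ind rT): w => [t [//]|t w tw IH t2 tw2].
  have {t2 tw2}-> : t2 = t by rewrite tw2.2 tw.2.
  have tw' := child_adj rT tw; case: (adj_child rT' (Gadj _ _ tw')) => // -[tr' GwE].
  have tr : t <> r by move=> tr; apply: tr'; rewrite tr.
  have pt : child r par (par t) t by [].
  have ptw : par t = w.
    apply: (Gloc t) => //; first by rewrite adj_sym; exact: (child_adj rT pt).
    by rewrite GwE -(IH _ pt).2.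
  by have := child_dep rT pt; have := child_dep rT tw; rewrite ptw; lia.
(* Two vertices with the same image have parents with the same image; induction identifies the
   parents, and [Gloc] the vertices. *)
have Ginj : injective G.
  move=> s; elim/(rooted_ind rT): s => [t|t w tw IH v] E.
    have [//|/eqP tr] := eqVneq r t.
    have [tr' _] : child r' par' (G (par t)) (G t) by apply: Gchild; split=> //; exact: nesym.
    by case: tr'; rewrite -E.
  have [wr' Ew] := Gchild _ _ tw.
  have vr : v <> r by move=> vr; apply: wr'; rewrite E vr.
  have pv : child r par (par v) v by [].
  have tv : t = par v by apply: IH; rewrite Ew E -(Gchild _ _ pv).2.
  apply: (Gloc t) => //; first exact: (child_adj rT tw).
  by rewrite tv; exact: (child_adj rT pv).
have Gsurj t' : exists t, G t = t'.
  elim/(rooted_ind rT'): t' => [|t' w' tw' [t tE]]; first by exists r.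
  have [a [b [c S]]] := star_exists hT t; have [_ H] := Gstar _ _ S.
  have : w' \in adj (G t) by rewrite tE; exact: (child_adj rT' tw').
  by rewrite H => /mapP[n _ ->]; exists n.
have [Gi GiK] := choice Gsurj.
have GK : cancel G Gi by move=> t; apply: Ginj; rewrite GiK.
have [g [gaut gE]] := local_isomorphism_automorphism GK GiK Gstar.
exists g; split=> //; apply: funext => x /=.
by have [u [v [uv ->]]] := edge_surj edE x; rewrite gE // Gphi.
Qed.

End Matching.

Lemma aut_triangle (G : graph) (g : G -> G) (O A B : G) :
  is_aut g -> triangle O A B -> triangle (g O) (g A) (g B).
Proof. by move=> [_ gE] [OA OB AB]; split; rewrite gE. Qed.

(** * Orbits of the automorphism group and the relation [sim] *)

Section Orbits.
Variables (R : realType) (T : graph).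
Hypothesis hT : is_T3 T.
Local Notation Tr3 := (dual_graph T).
Implicit Types (phi : Tr3 -> R[i]) (O A B : Tr3).

Lemma triangle_exists : exists O A B : Tr3, triangle O A B.
Proof.
have [ed edE] := edge_exists hT; have [[[r] _ _] _] := hT.
have [a [b [c S]]] := star_exists hT r.
by exists (ed r a), (ed r b), (ed r c); exact: star_triangle.
Qed.

Lemma triangle_match_aut phi phi' O A B O' A' B' :
  holomorphic phi -> holomorphic phi' -> triangle O A B -> triangle O' A' B' ->
  phi O = phi' O' -> phi A = phi' A' -> phi B = phi' B' ->
  exists g : Tr3 -> Tr3, is_aut g /\ phi = phi' \o g.
Proof.
have [ed edE] := edge_exists hT.
move=> /(holomorphic_edge hT edE) K /(holomorphic_edge hT edE) K'.
move=> /(triangle_star hT edE)[r [u1 [u2 [u3 [S [-> -> ->]]]]]].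
move=> /(triangle_star hT edE)[r' [v1 [v2 [v3 [S' [-> -> ->]]]]]].
exact: star_match_aut.
Qed.

(** Lets the image of a marked triangle under a bijection of triangles be marked in the induced
    order. *)
Lemma triangle_set_vertices (D : set Tr3) x y z : triangle_set D -> D x -> D y -> D z ->
  x <> y -> x <> z -> y <> z -> triangle x y z.
Proof.
move=> [O [A [B [[OA OB AB] ->]]]].
have [AO BO BA] : [/\ adj A O, adj B O & adj B A] by rewrite !(@adj_sym Tr3 _ O) (adj_sym B).
by move=> [[]|] -> [[]|] -> [[]|] -> // xy xz yz; split.
Qed.

Lemma same_orbit phi phi' : holomorphic phi -> holomorphic phi' ->
  (exists g : Tr3 -> Tr3, is_aut g /\ phi = phi' \o g) <->
  exists (D D' : set Tr3) (s : Tr3 -> Tr3),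
    [/\ triangle_set D, triangle_set D', set_bij D D' s
      & forall x, D x -> phi x = phi' (s x)].
Proof.
move=> hphi hphi'; split=> [[g [gaut ->]]|[D [D' [s [tD tD' [sf si _] sE]]]]].
  have [O [A [B tOAB]]] := triangle_exists.
  exists [set O; A; B], [set g O; g A; g B], g; split=> //.
  - by exists O, A, B.
  - by exists (g O), (g A), (g B); split=> //; exact: aut_triangle.
  split.
  - by move=> x [[]|] ->; [left; left|left; right|right].
  - by move=> x y _ _; have [gb _] := gaut; exact: bij_inj.
  - by move=> y [[]|] ->; [exists O|exists A|exists B] => //; [left; left|left; right|right].
case: (tD) => O [A [B [tOAB DE]]]; have [OA OB AB] := tOAB.
have [DO DA DB] : [/\ D O, D A & D B].
  by rewrite DE; split; [left; left|left; right|right].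
have neq (x y : Tr3) : D x -> D y -> adj x y -> s x <> s y.
  move=> Dx Dy xy /si E; move: xy; rewrite E ?adj_irrefl //; exact: mem_set.
apply: (@triangle_match_aut phi phi' O A B (s O) (s A) (s B)) => //; try exact: sE.
by apply: (triangle_set_vertices tD'); try (exact: sf); exact: neq.
Qed.

Lemma holomorphic_affine phi (th ta : R[i]) :
  holomorphic phi -> holomorphic (fun x => th * phi x + ta).
Proof.
have [ed edE] := edge_exists hT.
move=> /(holomorphic_edge hT edE) K; apply/(holomorphic_edge hT edE).
by move=> t w a b c d St Sw; apply: compatible_affine; exact: K.
Qed.

Lemma sim_refl (t : calT R) : sim Tr3 t t.
Proof.
have [ed edE] := edge_exists hT; have [O [A [B tOAB]]] := triangle_exists.
case Et : (val t) => [[p e] f].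
have [phi [hphi EO EA EB]] := holomorphic_extension hT edE p (e + p) (f + p) tOAB.
by exists phi, O, A, B, O, A, B; split=> //; rewrite /marked_image EO EA EB !addrK.
Qed.

Lemma sim_sym (t t' : calT R) : sim Tr3 t t' -> sim Tr3 t' t.
Proof.
by move=> [phi [O [A [B [O' [A' [B' [h T1 T2 E1 E2]]]]]]]]; exists phi, O', A', B', O, A, B.
Qed.

(** The two functions agree on the middle triangles, hence differ by an automorphism; it transports
    the first triangle into the domain of the second function. *)
Lemma sim_trans (t1 t2 t3 : calT R) :
  sim Tr3 t1 t2 -> sim Tr3 t2 t3 -> sim Tr3 t1 t3.
Proof.
move=> [phi [O1 [A1 [B1 [O2 [A2 [B2 [hphi T1 T2 E1 E2]]]]]]]].
move=> [psi [P2 [C2 [D2 [P3 [C3 [D3 [hpsi T2' T3 E2' E3]]]]]]]].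
have [EO EA EB] : marked_image phi O2 A2 B2 = marked_image psi P2 C2 D2 by rewrite -E2.
move: EA EB; rewrite EO => /addIr EA /addIr EB.
have [g [gaut phiE]] := triangle_match_aut hphi hpsi T2 T2' EO EA EB.
exists psi, (g O1), (g A1), (g B1), P3, C3, D3; split=> //; first exact: aut_triangle.
by rewrite E1 phiE.
Qed.

Lemma sim_equivalence : Equivalence (@sim R Tr3).
Proof. by split; [exact: sim_refl|exact: sim_sym|exact: sim_trans]. Qed.

(** Needed for transitivity on [CP1]: two representatives of the middle point differ by a
    similarity, which acts on holomorphic functions and so moves t along with t'. *)
Lemma sim_homothety (t t' s : calT R) : sim Tr3 t t' -> proj s = proj t' ->
  exists t0 : calT R, proj t0 = proj t /\ sim Tr3 t0 s.
Proof.
move=> [phi [O [A [B [O' [A' [B' [hphi T1 T2 E1 E2]]]]]]]].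
move=> /esym/proj_eqP[th [ta [th0 Es]]].
case Et : (val t) => [[p e] f].
have [t0 Et0] : exists t0 : calT R, val t0 = (th * p + ta, th * e, th * f).
  apply: calT_exists => -[/eqP + /eqP]; rewrite !mulf_eq0 (negbTE th0) /= => /eqP e0 /eqP f0.
  by apply: (calT_neq0 Et); rewrite e0 f0.
exists t0; split; first by symmetry; exact: proj_homothety th0 Et Et0.
have im O0 A0 B0 (x : C3 R) : x = marked_image phi O0 A0 B0 ->
    (th * x.1.1 + ta, th * x.1.2, th * x.2) =
    marked_image (fun y => th * phi y + ta) O0 A0 B0.
  by move=> -> /=; rewrite /marked_image; congr (_, _, _); ring.
exists (fun y => th * phi y + ta), O, A, B, O', A', B'; split=> //.
- exact: holomorphic_affine.
- by rewrite Et0 -(im _ _ _ _ E1) Et.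
- by rewrite Es (im _ _ _ _ E2).
Qed.

Lemma projsim_equivalence : Equivalence (@projsim R Tr3).
Proof.
split.
- by move=> P; have [t Pt] := proj_surj P; exists t, t; split=> //; exact: sim_refl.
- by move=> P Q [t [t' [Pt Qt' tt']]]; exists t', t; split=> //; exact: sim_sym.
move=> P Q S [t [t' [Pt Qt' tt']]] [s [s' [Qs Ss' ss']]].
have [t0 [Pt0 t0s]] : exists t0 : calT R, proj t0 = proj t /\ sim Tr3 t0 s.
  by apply: sim_homothety tt' _; rewrite Qs.
by exists t0, s'; split=> //; [rewrite Pt0|exact: sim_trans t0s ss'].
Qed.

End Orbits.

Theorem theorem1p8 (R : realType) (T : graph) (hT : is_T3 T) :
  let Tr3 := dual_graph T in
  (* (1) *)
  [/\ is_quadric 3 (calS R),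
      exists M : C3 R -> set (C3 R),
        multivalued M /\ calS R = [set w | M w.1 w.2],
      forall phi : Tr3 -> R[i],
        holomorphic phi <->
        forall O A B C D : Tr3, adjacent_triangles O A B C D ->
          calS R ((phi O, phi A - phi O, phi B - phi O),
                (phi C, phi O - phi C, phi D - phi C))
    & (* extension from a triangle *)
      [/\ forall (O A B : Tr3) (o a b : R[i]), triangle O A B ->
            exists phi : Tr3 -> R[i],
              [/\ holomorphic phi, phi O = o, phi A = a & phi B = b],
          forall (O A B C D : Tr3) (o a b : R[i]),
            adjacent_triangles O A B C D ->
            exists c d : R[i], forall c' d' : R[i],
              (exists phi : Tr3 -> R[i],
                 [/\ holomorphic phi,
                     [/\ phi O = o, phi A = a & phi B = b],
                     phi C = c' & phi D = d']) <->
              (c', d') = (c, d) \/ (c', d') = (d, c),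
          forall (O A B : Tr3) (o a b : R[i]) (F : nat -> Tr3 -> option R[i]),
            triangle O A B -> extension_run O A B o a b F ->
            exists phi : Tr3 -> R[i], holomorphic phi /\ run_limit F phi
        & forall (O A B : Tr3) (phi : Tr3 -> R[i]),
            triangle O A B -> holomorphic phi ->
            exists F : nat -> Tr3 -> option R[i],
              [/\ extension_run O A B (phi O) (phi A) (phi B) F,
                  exhaustive F & run_limit F phi]]]
  /\
  (* (2) *)
  (forall phi phi' : Tr3 -> R[i], holomorphic phi -> holomorphic phi' ->
     (exists g : Tr3 -> Tr3, is_aut g /\ phi = phi' \o g) <->
     exists (D D' : set Tr3) (s : Tr3 -> Tr3),
       [/\ triangle_set D, triangle_set D', set_bij D D' s
         & forall x, D x -> phi x = phi' (s x)])
  /\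
  (* (3) *)
  Equivalence (@sim R Tr3)
  /\
  (* (4) *)
  (correspondence (projS R) /\ Equivalence (@projsim R Tr3)).
Proof.
have [ed edE] := edge_exists hT.
split; [split|split; [|split; [|split]]].
- exact: calS_quadric.
- exists (fun t => [set t' | calS R (t, t')]); split; first exact: calS_multivalued.
  by apply/seteqP; split=> -[t t'].
- move=> phi; exact: (holomorphic_calS hT edE).
- split.
  + move=> *; exact: (holomorphic_extension hT edE).
  + move=> *; exact: (holomorphic_extension_step hT edE).
  + move=> O A B o a b F; exact: (extension_run_holomorphic hT edE).
  + move=> O A B phi; exact: (exhaustive_run hT edE).
- exact: same_orbit.
- exact: sim_equivalence.
- exact: projS_correspondence.
- exact: projsim_equivalence.
Qed.
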